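(* Let $F$ be a zippable set functor equipped with an encoding $(A,\flat)$ and a refinement interface $(W,\mathrm{init},\mathrm{update})$ with run time factor $p(c)$. Then the generic coalgebraic partition refinement algorithm (which starts from the partition of the state set induced by $F!\cdot c\colon C\to F1$, iteratively splits blocks, and accesses $F$ only through the encoding $\flat$, the values $F!(c(x))$, calls to $\mathrm{init}$ and $\mathrm{update}$, and comparisons of values in $F3$) computes the behavioural equivalence relation on an input $F$-coalgebra $c\colon C\to FC$ with $n$ states and $m$ edges in $\mathcal{O}((m+n)\cdot\log n\cdot p(c))$ steps.
   Context: A set functor $F$ assigns to each set $X$ a set $FX$ and to each map $f\colon X\to Y$ a map $Ff\colon FX\to FY$, preserving identities and composition. An $F$-coalgebra is a set $C$ with a map $c\colon C\to FC$; a morphism $h\colon (C,c)\to(D,d)$ is a map with $Fh\cdot c=d\cdot h$; states $x,y\in C$ are behaviourally equivalent if some coalgebra morphism $h$ has $h(x)=h(y)$. $\mathcal{B}_\omega X$ denotes the set of finite bags (finitely supported maps $X\to\mathbb{N}$) over $X$; $|\ell|$ is the size of a bag counted with multiplicity; $\{\!|\cdots|\!\}$ denotes multiset comprehension. Let $1=\{*\}$, $!\colon X\to 1$ the unique map, $3=\{0,1,2\}$, and for $S\subseteq B\subseteq X$ let $\chi_S^B\colon X\to 3$ send $x$ to $2$ if $x\in S$, to $1$ if $x\in B\setminus S$, and to $0$ otherwise. An encoding of $F$ is a set $A$ of labels with maps $\flat\colon FX\to\mathcal{B}_\omega(A\times X)$, one for each set $X$ (not required to be natural). A coalgebra $c\colon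 C\to FC$ has $n=|C|$ states and $m=\sum_{x\in C}|\flat(c(x))|$ edges. A refinement interface for $F$ (with respect to $(A,\flat)$) consists of a set $W$ of weights and functions $\mathrm{init}\colon F1\times\mathcal{B}_\omega A\to W$ and $\mathrm{update}\colon \mathcal{B}_\omega A\times W\to W\times F3\times W$ such that there exists a family of maps $w\colon \mathcal{P}X\to(FX\to W)$, one per set $X$, with $\mathrm{init}(F!(t),\{\!|a\mid (a,x)\in\flat(t)|\!\})=w(X)(t)$ and $\mathrm{update}(\{\!|a\mid (a,x)\in\flat(t),x\in S|\!\},w(B)(t))=(w(S)(t),F\chi_S^B(t),w(B\setminus S)(t))$ for all $t\in FX$ and $S\subseteq B\subseteq X$. The interface has run time factor $p(c)$ if for every map $c\colon X\to FY$: (1) for $x\in X$, $t=c(x)$, $S\subseteq B\subseteq Y$, the calls $\mathrm{init}(F!(t),\ell)$ with $\ell=\{\!|a\mid(a,y)\in\flat(t)|\!\}$ and $\mathrm{update}(\ell,w(B)(t))$ with $\ell=\{\!|a\mid (a,y)\in\flat(t),y\in S|\!\}$ run in time $\mathcal{O}(|\ell|\cdot p(c))$; and (2) equality of values in $\{F\chi_S^B(c(q))\mid q\in X, S\subseteq B\subseteq Y\}\subseteq F3$ can be checked in time $\mathcal{O}(p(c))$. $F$ is zippable if for all sets $X,Y$ the map $\langle F(X+!),F(!+Y)\rangle\colon F(X+Y)\to F(X+1)\times F(1+Y)$ is injective.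
   Formalization: Values in F3 are compared by a three-way comparison for a linear order in time O(p(c)), since equality tests alone force quadratically many tests; |ℓ| = 0 counts as 1, every call takes at least one step, and the time bound is for n ≥ 2 because log 1 = 0. *)

(* Defs.v *)
From HB Require Import structures.
From mathcomp Require Import all_boot all_order all_algebra.
Set Warnings "-notation-incompatible-prefix".
From mathcomp Require Import finmap multiset.
Set Warnings "notation-incompatible-prefix".
From mathcomp Require Import boolp classical_sets reals.

Set Implicit Arguments.
Unset Strict Implicit.
Unset Printing Implicit Defensive.

Import Order.TTheory GRing.Theory Num.Theory.

Local Open Scope classical_set_scope.

Record set_functor := SetFunctor {
  fobj :> Type -> Type;
  fmap : forall X Y : Type, (X -> Y) -> fobj X -> fobj Y;
  fmap_id : forall (X : Type) (t : fobj X), fmap (fun x => x) t = t;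
  fmap_comp : forall (X Y Z : Type) (g : Y -> Z) (f : X -> Y) (t : fobj X),
    fmap (fun x => g (f x)) t = fmap g (fmap f t)
}.

Definition bang (X : Type) : X -> unit := fun=> tt.

Definition sum_map (X X' Y Y' : Type) (f : X -> X') (g : Y -> Y')
    (z : X + Y) : X' + Y' :=
  match z with inl x => inl (f x) | inr y => inr (g y) end.

Definition zippable (F : set_functor) : Prop :=
  forall X Y : Type, injective (fun t : F (X + Y)%type =>
    (fmap (sum_map (fun x : X => x) (@bang Y)) t,
     fmap (sum_map (@bang X) (fun y : Y => y)) t)).

Definition coalg_morphism (F : set_functor) (C D : Type)
    (c : C -> F C) (d : D -> F D) (h : C -> D) : Prop :=
  forall x : C, fmap h (c x) = d (h x).

Definition behaviourally_equivalent (F : set_functor) (C : Type)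
    (c : C -> F C) (x y : C) : Prop :=
  exists (D : Type) (d : D -> F D) (h : C -> D),
    coalg_morphism c d h /\ h x = h y.

(* A multiset is a finitely supported map to nat; {classic T} is T with the
   choice structure given by the classical axioms. *)
Definition bag (T : Type) : Type := multiset {classic T}.

(* The elements of a bag, each repeated according to its multiplicity. *)
Definition elems (T : Type) (b : bag T) : seq T := @enum_mset {classic T} b.

Definition bag_size (T : Type) (b : bag T) : nat := size (elems b).

Definition bag_of (T : Type) (s : seq T) : bag T := @seq_mset {classic T} s.

Definition encoding (F : set_functor) (A : Type) : Type :=
  forall X : Type, F X -> bag (A * X).

(* The bag of all a with (a, x) in b. *)
Definition labels (A X : Type) (b : bag (A * X)) : bag A :=
  bag_of [seq e.1 | e <- elems b].

(* The bag of all a with (a, x) in b and x in S. *)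
Definition labels_into (A X : Type) (b : bag (A * X)) (S : set X) : bag A :=
  bag_of [seq e.1 | e <- elems b & `[< S e.2 >]].

Definition num_edges (F : set_functor) (A : Type) (flat : encoding F A)
    (C : finType) (c : C -> F C) : nat :=
  (\sum_(x : C) bag_size (flat C (c x)))%N.

Definition zero3 : 'I_3 := @Ordinal 3 0 isT.
Definition one3 : 'I_3 := @Ordinal 3 1 isT.
Definition two3 : 'I_3 := @Ordinal 3 2 isT.

Definition chi (X : Type) (S B : set X) (x : X) : 'I_3 :=
  if `[< S x >] then two3 else if `[< B x >] then one3 else zero3.

Definition weight_family (F : set_functor) (A : Type) (flat : encoding F A)
    (W : Type) (init : F unit -> bag A -> W)
    (update : bag A -> W -> W * F 'I_3 * W)
    (w : forall X : Type, set X -> F X -> W) : Prop :=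
  forall (X : Type) (t : F X),
    init (fmap (@bang X) t) (labels (flat X t)) = w X setT t /\
    forall S B : set X, S `<=` B ->
      update (labels_into (flat X t) S) (w X B t) =
        (w X S t, fmap (chi S B) t, w X (B `\` S) t).

Record refinement_interface (F : set_functor) (A : Type)
    (flat : encoding F A) := RefinementInterface {
  weight : Type;
  init : F unit -> bag A -> weight;
  update : bag A -> weight -> weight * F 'I_3 * weight;
  weight_familyP : exists w, weight_family flat init update w
}.

(* How long the calls to an interface take.  Values of F 3 are compared, and
   in particular tested for equality, by a three-way comparison [cmp3] for
   some linear order (e.g. the order of their representations): the algorithm
   groups states by their values, which is impossible in less than a
   quadratic number of tests if only the outcome of equality tests is known. *)
Record implementation (F : set_functor) (A : Type) (flat : encoding F A)
    (I : refinement_interface flat) := Implementation {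
  cmp3 : F 'I_3 -> F 'I_3 -> comparison;
  cmp3_eq : forall u v, cmp3 u v = Eq <-> u = v;
  cmp3_sym : forall u v, cmp3 v u = CompOpp (cmp3 u v);
  cmp3_trans : forall u v w, cmp3 u v = Lt -> cmp3 v w = Lt -> cmp3 u w = Lt;
  time_init : F unit -> bag A -> nat;
  time_update : bag A -> weight I -> nat;
  time_cmp3 : F 'I_3 -> F 'I_3 -> nat;
  time_init_gt0 : forall v l, (0 < time_init v l)%N;
  time_update_gt0 : forall l w, (0 < time_update l w)%N;
  time_cmp3_gt0 : forall u v, (0 < time_cmp3 u v)%N
}.

Definition observations (F : set_functor) (X Y : Type) (c : X -> F Y) :
    set (F 'I_3) :=
  [set v | exists (q : X) (S B : set Y), S `<=` B /\ v = fmap (chi S B) (c q)].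

(* The length of an empty bag counts as 1, since no call takes no time. *)
Definition has_run_time_factor (R : realType) (F : set_functor) (A : Type)
    (flat : encoding F A) (I : refinement_interface flat)
    (M : implementation I) (p : forall X Y : Type, (X -> F Y) -> R) : Prop :=
  exists2 K : R, (0 < K)%R &
  forall (X Y : Type) (c : X -> F Y)
         (w : forall Z : Type, set Z -> F Z -> weight I),
    weight_family flat (@init _ _ _ I) (@update _ _ _ I) w ->
  [/\ forall x : X,
        let t := c x in let l := labels (flat Y t) in
        ((time_init M (fmap (@bang Y) t) l)%:R
           <= K * ((maxn 1 (bag_size l))%:R * p X Y c))%R,
      forall (x : X) (S B : set Y), S `<=` B ->
        let t := c x in let l := labels_into (flat Y t) S in
        ((time_update M l (w Y B t))%:R
           <= K * ((maxn 1 (bag_size l))%:R * p X Y c))%R &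
      forall u v : F 'I_3, observations c u -> observations c v ->
        ((time_cmp3 M u v)%:R <= K * p X Y c)%R].

(* A program maps an initial memory to a value, a final memory and the number
   of steps taken.  Reading or writing a variable or an array entry takes one
   step; lists are linked lists that store their length. *)
Definition prog (St T : Type) : Type := St -> T * St * nat.

Section Programs.
Context {St T U : Type}.

Definition ret (x : T) : prog St T := fun s => (x, s, 0%N).

Definition bind (e : prog St T) (f : T -> prog St U) : prog St U := fun s =>
  let: (x, s1, k1) := e s in let: (y, s2, k2) := f x s1 in (y, s2, (k1 + k2)%N).

Definition read (f : St -> T) : prog St T := fun s => (f s, s, 1%N).

(* A call of an external function that takes k steps and returns x. *)
Definition call (k : nat) (x : T) : prog St T := fun s => (x, s, k).

End Programs.

Definition write (St : Type) (g : St -> St) : prog St unit :=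
  fun s => (tt, g s, 1%N).

Notation "'let*' x := e 'in' f" := (bind e (fun x => f))
  (at level 200, x name, e at level 200, f at level 200).
Notation "e1 ;;; e2" := (bind e1 (fun _ : unit => e2))
  (at level 110, right associativity).

Definition when (St : Type) (b : bool) (e : prog St unit) : prog St unit :=
  if b then e else ret tt.

Fixpoint for_each (St T : Type) (s : seq T) (f : T -> prog St unit) :
    prog St unit :=
  if s is x :: s' then call 1 tt ;;; f x ;;; for_each s' f else ret tt.

(* Runs f on each element of s and collects the results other than None. *)
Fixpoint collect (St T U : Type) (s : seq T) (f : T -> prog St (option U)) :
    prog St (seq U) :=
  if s is x :: s' then
    call 1 tt ;;;
    let* o := f x in
    let* r := collect s' f in
    ret (if o is Some y then y :: r else r)
  else ret [::].

(* [while_run b e s s' k]: the loop "while b do e", started in memory s,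
   terminates in memory s' after k steps. *)
Inductive while_run (St : Type) (b : St -> bool) (e : prog St unit) :
    St -> St -> nat -> Prop :=
| WhileDone s : ~~ b s -> while_run b e s s 1
| WhileStep s s1 s' k1 k : b s -> e s = (tt, s1, k1) ->
    while_run b e s1 s' k -> while_run b e s s' (1 + k1 + k)%N.

Definition set_at (K : eqType) (V : Type) (a : K -> V) (i : K) (v : V) :
    K -> V :=
  fun j => if j == i then v else a j.

Record edge (A C : Type) := Edge {
  edge_id : nat;
  edge_src : C;
  edge_lab : A;
  edge_tgt : C
}.

(* Two partitions of the state set C are maintained: a partition P and a
   coarser partition Q.  Blocks are named by natural numbers, and a block of Q
   is represented by the list of the blocks of P it consists of.  Weights are
   stored in memory cells, also named by natural numbers: all edges from x
   into a block B of Q have the same cell, which contains w(B)(c(x)). *)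
Record memory (F : set_functor) (A W C : Type) := Memory {
  pnum : nat;                           (* number of blocks of P *)
  pblk : C -> nat;                      (* block of P of a state *)
  pmem : nat -> seq C;                  (* states of a block of P *)
  qnum : nat;                           (* number of blocks of Q *)
  qblk : nat -> nat;                    (* block of Q of a block of P *)
  qmem : nat -> seq nat;                (* blocks of P in a block of Q *)
  work : seq nat;                       (* blocks of Q that are not in P *)
  pred_edges : C -> seq (edge A C);     (* edges into a state *)
  to_sub : C -> seq (edge A C);         (* edges from a state into S *)
  last_w : nat -> nat;                  (* cell of an edge *)
  cnum : nat;                           (* number of cells *)
  cell : nat -> option W;               (* contents of a cell *)
  mark : nat -> seq (C * nat);          (* marked states of a block of P,
                                           with the cell of their edges *)
  touched : seq (nat * F 'I_3)          (* blocks with marked states *)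
}.

Section Setters.
Context {F : set_functor} {A W : Type} {C : finType}.
Local Notation memory := (memory F A W C).

Definition set_pnum v (s : memory) : memory :=
  let: Memory _ a2 a3 a4 a5 a6 a7 a8 a9 a10 a11 a12 a13 a14 := s in
  Memory v a2 a3 a4 a5 a6 a7 a8 a9 a10 a11 a12 a13 a14.
Definition set_pblk v (s : memory) : memory :=
  let: Memory a1 _ a3 a4 a5 a6 a7 a8 a9 a10 a11 a12 a13 a14 := s in
  Memory a1 v a3 a4 a5 a6 a7 a8 a9 a10 a11 a12 a13 a14.
Definition set_pmem v (s : memory) : memory :=
  let: Memory a1 a2 _ a4 a5 a6 a7 a8 a9 a10 a11 a12 a13 a14 := s in
  Memory a1 a2 v a4 a5 a6 a7 a8 a9 a10 a11 a12 a13 a14.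
Definition set_qnum v (s : memory) : memory :=
  let: Memory a1 a2 a3 _ a5 a6 a7 a8 a9 a10 a11 a12 a13 a14 := s in
  Memory a1 a2 a3 v a5 a6 a7 a8 a9 a10 a11 a12 a13 a14.
Definition set_qblk v (s : memory) : memory :=
  let: Memory a1 a2 a3 a4 _ a6 a7 a8 a9 a10 a11 a12 a13 a14 := s in
  Memory a1 a2 a3 a4 v a6 a7 a8 a9 a10 a11 a12 a13 a14.
Definition set_qmem v (s : memory) : memory :=
  let: Memory a1 a2 a3 a4 a5 _ a7 a8 a9 a10 a11 a12 a13 a14 := s in
  Memory a1 a2 a3 a4 a5 v a7 a8 a9 a10 a11 a12 a13 a14.
Definition set_work v (s : memory) : memory :=
  let: Memory a1 a2 a3 a4 a5 a6 _ a8 a9 a10 a11 a12 a13 a14 := s in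
  Memory a1 a2 a3 a4 a5 a6 v a8 a9 a10 a11 a12 a13 a14.
Definition set_pred_edges v (s : memory) : memory :=
  let: Memory a1 a2 a3 a4 a5 a6 a7 _ a9 a10 a11 a12 a13 a14 := s in
  Memory a1 a2 a3 a4 a5 a6 a7 v a9 a10 a11 a12 a13 a14.
Definition set_to_sub v (s : memory) : memory :=
  let: Memory a1 a2 a3 a4 a5 a6 a7 a8 _ a10 a11 a12 a13 a14 := s in
  Memory a1 a2 a3 a4 a5 a6 a7 a8 v a10 a11 a12 a13 a14.
Definition set_last_w v (s : memory) : memory :=
  let: Memory a1 a2 a3 a4 a5 a6 a7 a8 a9 _ a11 a12 a13 a14 := s in
  Memory a1 a2 a3 a4 a5 a6 a7 a8 a9 v a11 a12 a13 a14.
Definition set_cnum v (s : memory) : memory :=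
  let: Memory a1 a2 a3 a4 a5 a6 a7 a8 a9 a10 _ a12 a13 a14 := s in
  Memory a1 a2 a3 a4 a5 a6 a7 a8 a9 a10 v a12 a13 a14.
Definition set_cell v (s : memory) : memory :=
  let: Memory a1 a2 a3 a4 a5 a6 a7 a8 a9 a10 a11 _ a13 a14 := s in
  Memory a1 a2 a3 a4 a5 a6 a7 a8 a9 a10 a11 v a13 a14.
Definition set_mark v (s : memory) : memory :=
  let: Memory a1 a2 a3 a4 a5 a6 a7 a8 a9 a10 a11 a12 _ a14 := s in
  Memory a1 a2 a3 a4 a5 a6 a7 a8 a9 a10 a11 a12 v a14.
Definition set_touched v (s : memory) : memory :=
  let: Memory a1 a2 a3 a4 a5 a6 a7 a8 a9 a10 a11 a12 a13 _ := s in
  Memory a1 a2 a3 a4 a5 a6 a7 a8 a9 a10 a11 a12 a13 v.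

Definition put_pblk x b : prog memory unit :=
  write (fun s => set_pblk (set_at (pblk s) x b) s).
Definition put_pmem b l : prog memory unit :=
  write (fun s => set_pmem (set_at (pmem s) b l) s).
Definition put_qblk b q : prog memory unit :=
  write (fun s => set_qblk (set_at (qblk s) b q) s).
Definition put_qmem q l : prog memory unit :=
  write (fun s => set_qmem (set_at (qmem s) q l) s).
Definition put_pred_edges x l : prog memory unit :=
  write (fun s => set_pred_edges (set_at (pred_edges s) x l) s).
Definition put_to_sub x l : prog memory unit :=
  write (fun s => set_to_sub (set_at (to_sub s) x l) s).
Definition put_last_w (e : edge A C) i : prog memory unit :=
  write (fun s => set_last_w (set_at (last_w s) (edge_id e) i) s).
Definition put_cell i w : prog memory unit :=
  write (fun s => set_cell (set_at (cell s) i (Some w)) s).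
Definition put_mark b l : prog memory unit :=
  write (fun s => set_mark (set_at (mark s) b l) s).

Definition empty_memory : memory :=
  Memory 0 (fun=> 0%N) (fun=> [::]) 0 (fun=> 0%N) (fun=> [::]) [::]
         (fun=> [::]) (fun=> [::]) (fun=> 0%N) 0 (fun=> None) (fun=> [::]) [::].

End Setters.

Section Algorithm.
Context {F : set_functor} {A : Type} {flat : encoding F A}.
Context {I : refinement_interface flat} (M : implementation I).
Context {C : finType} (c : C -> F C).

Local Notation store := (memory F A (weight I) C).
Local Notation group := (F 'I_3 * seq C)%type.

(* Merging two lists of groups sorted by their values; groups with the same
   value are united.  The lists are linked lists, so that the concatenation
   and the rest of a list when the other one is exhausted take one step. *)
Fixpoint merge_groups (g1 : seq group) : seq group -> seq group * nat :=
  match g1 with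
  | [::] => fun g2 => (g2, 1%N)
  | (u, xs) :: g1' => fix merge_aux (g2 : seq group) : seq group * nat :=
      match g2 with
      | [::] => (g1, 1%N)
      | (v, ys) :: g2' =>
          let k := (1 + time_cmp3 M u v)%N in
          match cmp3 M u v with
          | Lt => let: (r, k') := merge_groups g1' g2 in
                  ((u, xs) :: r, (k + k')%N)
          | Eq => let: (r, k') := merge_groups g1' g2' in
                  ((u, xs ++ ys) :: r, (k + k')%N)
          | Gt => let: (r, k') := merge_aux g2' in
                  ((v, ys) :: r, (k + k')%N)
          end
      end
  end.

Fixpoint merge_pass (gs : seq (seq group)) : seq (seq group) * nat :=
  match gs with
  | g1 :: g2 :: gs' =>
      let: (g, k) := merge_groups g1 g2 in
      let: (r, k') := merge_pass gs' in (g :: r, (1 + k + k')%N)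
  | _ => (gs, 1%N)
  end.

(* Every pass halves the length of gs, so d = size gs is large enough. *)
Fixpoint merge_passes (d : nat) (gs : seq (seq group)) : seq group * nat :=
  match d, gs with
  | d'.+1, _ :: _ :: _ =>
      let: (gs', k) := merge_pass gs in
      let: (r, k') := merge_passes d' gs' in (r, (1 + k + k')%N)
  | _, _ => (flatten gs, 1%N)
  end.

Definition group_by (s : seq (F 'I_3 * C)) : prog store (seq group) :=
  let: (r, k) :=
    merge_passes (size s) [seq [:: (vx.1, [:: vx.2])] | vx <- s] in
  call (size s + k) r.

Definition label_bag (es : seq (edge A C)) : bag A :=
  bag_of [seq edge_lab e | e <- es].

Definition call_init (v : F unit) (es : seq (edge A C)) : prog store (weight I) :=
  let l := label_bag es in call (size es + time_init M v l) (init I v l).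

Definition call_update (es : seq (edge A C)) (w : weight I) :
    prog store (weight I * F 'I_3 * weight I) :=
  let l := label_bag es in call (size es + time_update M l w) (update l w).

Definition call_cmp3 (u v : F 'I_3) : prog store comparison :=
  call (time_cmp3 M u v) (cmp3 M u v).

Definition new_cell (w : weight I) : prog store nat :=
  let* i := read (@cnum _ _ _ _) in
  write (set_cnum i.+1) ;;; put_cell i w ;;; ret i.

Definition type_of (x : C) : F unit := fmap (@bang C) (c x).

(* F 1 embeds into F 3 along the constant map with value 0, which maps
   type_of x to fmap (chi set0 set0) (c x). *)
Definition type3 (x : C) : F 'I_3 := fmap (fun=> zero3) (type_of x).

Definition edges : seq (edge A C) :=
  let es := [seq (x, e) | x <- enum C, e <- elems (flat (c x))] in
  [seq Edge ie.1 ie.2.1 ie.2.2.1 ie.2.2.2 | ie <- zip (iota 0 (size es)) es].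

Definition add_edge (e : edge A C) : prog store unit :=
  let* es := read (fun s => to_sub s (edge_src e)) in
  put_to_sub (edge_src e) (e :: es) ;;;
  let* ps := read (fun s => pred_edges s (edge_tgt e)) in
  put_pred_edges (edge_tgt e) (e :: ps).

Definition init_weights (x : C) : prog store unit :=
  let* es := read (fun s => to_sub s x) in
  let* w := call_init (type_of x) es in
  let* i := new_cell w in
  for_each es (fun e => put_last_w e i) ;;;
  put_to_sub x [::].

(* A new block of P, in the block q of Q and consisting of the states xs. *)
Definition new_block (q : nat) (xs : seq C) : prog store unit :=
  let* i := read (@pnum _ _ _ _) in
  write (set_pnum i.+1) ;;;
  put_pmem i xs ;;;
  for_each xs (fun x => put_pblk x i) ;;;
  put_qblk i q ;;;
  let* bs := read (fun s => qmem s q) in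
  put_qmem q (i :: bs) ;;;
  when (size bs == 1%N)
    (let* wk := read (@work _ _ _ _) in write (set_work (q :: wk))).

Definition initialize : prog store unit :=
  for_each edges add_edge ;;;
  for_each (enum C) init_weights ;;;
  let* vs := collect (enum C) (fun x => ret (Some (type3 x, x))) in
  let* gs := group_by vs in
  write (set_qnum 1) ;;;
  for_each gs (fun g => new_block 0 g.2).

(* In [visit_edge] and [update_state], the cell i is never empty (None). *)
Definition visit_edge (e : edge A C) : prog store unit :=
  let x := edge_src e in
  let* b := read (fun s => pblk s x) in
  let* mk := read (fun s => mark s b) in
  let* i := read (fun s => last_w s (edge_id e)) in
  when (nilp mk)
    (let* ow := read (fun s => cell s i) in
     if ow is Some w then
       let* r := call_update [::] w in
       let* td := read (@touched _ _ _ _) in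
       write (set_touched ((b, r.1.2) :: td))
     else ret tt) ;;;
  let* es := read (fun s => to_sub s x) in
  when (nilp es) (put_mark b ((x, i) :: mk)) ;;;
  put_to_sub x (e :: es).

(* Updates the weights of the marked state x and returns (v, x), where
   v = F chi_S^B (c x), unless v is the value v0 of the unmarked states. *)
Definition update_state (v0 : F 'I_3) (xi : C * nat) :
    prog store (option (F 'I_3 * C)) :=
  let: (x, i) := xi in
  let* es := read (fun s => to_sub s x) in
  put_to_sub x [::] ;;;
  let* ow := read (fun s => cell s i) in
  if ow is Some w then
    let* r := call_update es w in
    put_cell i r.2 ;;;
    let* j := new_cell r.1.1 in
    for_each es (fun e => put_last_w e j) ;;;
    let* o := call_cmp3 r.1.2 v0 in
    ret (if o is Eq then None else Some (r.1.2, x))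
  else ret None.

(* Moves the states xs of the block b of P to a new block.  The lists pmem are
   doubly linked, so that a state is removed in one step. *)
Definition split_off (b : nat) (xs : seq C) : prog store unit :=
  for_each xs (fun x =>
    let* ys := read (fun s => pmem s b) in put_pmem b (rem x ys)) ;;;
  let* q := read (fun s => qblk s b) in
  new_block q xs.

Definition regroup (bv : nat * F 'I_3) : prog store unit :=
  let: (b, v0) := bv in
  let* mk := read (fun s => mark s b) in
  put_mark b [::] ;;;
  let* vs := collect mk (update_state v0) in
  let* gs := group_by vs in
  let* sz := read (fun s => size (pmem s b)) in
  (* if no state of b has value v0, then the first group remains in b *)
  let rest := if size vs == sz then behead gs else gs in
  for_each rest (fun g => split_off b g.2).

(* P is refined by the kernel of F chi_S^B . c, where S is the block b of P
   and B was the block of Q containing b. *)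
Definition refine_by (b : nat) : prog store unit :=
  let* ys := read (fun s => pmem s b) in
  for_each ys (fun y =>
    let* es := read (fun s => pred_edges s y) in for_each es visit_edge) ;;;
  let* td := read (@touched _ _ _ _) in
  write (set_touched [::]) ;;;
  for_each td regroup.

(* Picks a block B of Q and a block S of P with S a proper subset of B and
   2|S| <= |B|, namely the smaller one of two blocks of P in B; replaces B by S
   and B \ S in Q; and refines P accordingly. *)
Definition refine_step : prog store unit :=
  let* wk := read (@work _ _ _ _) in
  if wk is q :: wk' then
    let* bs := read (fun s => qmem s q) in
    if bs is b1 :: b2 :: bs' then
      let* n1 := read (fun s => size (pmem s b1)) in
      let* n2 := read (fun s => size (pmem s b2)) in
      let: (b, b') := if (n1 <= n2)%N then (b1, b2) else (b2, b1) in
      put_qmem q (b' :: bs') ;;;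
      let* q' := read (@qnum _ _ _ _) in
      write (set_qnum q'.+1) ;;;
      put_qmem q' [:: b] ;;;
      put_qblk b q' ;;;
      when (nilp bs') (write (set_work wk')) ;;;
      refine_by b
    else write (set_work wk')
  else ret tt.

(* The algorithm terminates on c after k steps; two states x, y are in the
   same block of the computed partition iff P x = P y. *)
Definition partition_refinement (P : C -> nat) (k : nat) : Prop :=
  exists (s s' : store) (k1 k2 : nat),
    [/\ initialize empty_memory = (tt, s, k1),
        while_run (fun s => ~~ nilp (work s)) refine_step s s' k2,
        P = pblk s' & k = (k1 + k2)%N].

End Algorithm.

(* Main.v *)
Require Import Defs.
From mathcomp Require Import all_boot all_order all_algebra.
From mathcomp Require Import reals exp.
From mathcomp Require Import finmap multiset boolp classical_sets.
From mathcomp Require Import zify ring.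

Set Implicit Arguments.
Unset Strict Implicit.
Unset Printing Implicit Defensive.

(** The loop maintains that P is coarser than behavioural equivalence and that
    states in one block of P have the same image under [F q . c], where [q] is
    the quotient map of Q.  Replacing a block [B] of Q by [S] and [B \ S] keeps
    the latter because P is refined by the kernel of [F chi_S^B . c] and [F] is
    zippable; the former because [chi_S^B] is constant on the blocks of P and
    hence factors through every coalgebra morphism.  When Q = P, the blocks of
    P form a quotient coalgebra.

    The running time is paid for by two potentials.  An edge is visited only
    when its target moves to a block of Q of at most half the size, so the sum
    of [log |Q-block of y|] over all states [y], weighted by one plus the
    in-degree, pays for all calls to the interface.  Grouping [n] states into
    classes of sizes [n_i] by a merge sort that unites equal values costs only
    [O(n + sum_i n_i log (n / n_i))] comparisons.  The second term is at most
    the decrease of the sum of [log |P-block of x|] over all states [x]. *)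

(** The weight family [w] is only known to exist; the proof fixes one and ties the contents of the
    memory cells to it by [cells_ok]. The obstacle is that a block [S] must be processed in time
    depending on [S] and the edges into [S], whereas [F chi_S^B . c] is defined on all states. A
    state [x] without edges into [S] needs no call: [update] would receive the same empty bag for
    [S] as for the empty set, so the weight of [B \ S] at [c x] is that of [B], and the value of [x]
    is F chi_0^B (c x), with 0 the empty set. This value is constant on each block of P, because
    chi_0^B factors through the quotient map of Q. One call per touched block therefore determines
    the value of all its unmarked states. While the touched blocks are regrouped, the cells of some
    states already refer to the new Q and those of others still to the old one.

    Costs are counted in natural numbers, in multiples of a bound [T] for the time of a call per
    label; real numbers enter only in the theorem. *)

Local Notation tl := (trunc_log 2).

(** * Weakest preconditions *)

(** A program is a total function, so this is total correctness; the postcondition also sees the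
    number of steps. *)
Definition wp (St T : Type) (e : prog St T) (Q : T -> St -> nat -> Prop)
    (s : St) : Prop :=
  let: (x, s', k) := e s in Q x s' k.

Lemma wp_conseq (St T : Type) (e : prog St T) (Q Q' : T -> St -> nat -> Prop) s :
  (forall x s' k, Q x s' k -> Q' x s' k) -> wp e Q s -> wp e Q' s.
Proof. by move=> QQ'; rewrite /wp; case: (e s) => -[x s'] k; apply: QQ'. Qed.

Lemma wp_ret (St T : Type) (x : T) (Q : T -> St -> nat -> Prop) s :
  Q x s 0 -> wp (ret x) Q s.
Proof. by []. Qed.

Lemma wp_read (St T : Type) (f : St -> T) (Q : T -> St -> nat -> Prop) s :
  Q (f s) s 1 -> wp (read f) Q s.
Proof. by []. Qed.

Lemma wp_call (St T : Type) n (x : T) (Q : T -> St -> nat -> Prop) s :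
  Q x s n -> wp (call n x) Q s.
Proof. by []. Qed.

Lemma wp_write (St : Type) (g : St -> St) (Q : unit -> St -> nat -> Prop) s :
  Q tt (g s) 1 -> wp (write g) Q s.
Proof. by []. Qed.

Lemma wp_when (St : Type) (b : bool) (e : prog St unit) Q s :
  (b -> wp e Q s) -> (~~ b -> Q tt s 0) -> wp (when b e) Q s.
Proof. by case: b => H1 H2; [apply: H1|apply: H2]. Qed.

Lemma wp_bind (St T U : Type) (e : prog St T) (f : T -> prog St U) Q s :
  wp e (fun x s1 k1 => wp (f x) (fun y s2 k2 => Q y s2 (k1 + k2)) s1) s ->
  wp (bind e f) Q s.
Proof.
rewrite /wp /bind; case: (e s) => -[x s1] k1.
by case: (f x s1) => -[y s2] k2.
Qed.

(** The invariant is indexed by the processed prefix and the steps spent on it; the summand 1 is the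
    step with which [for_each] fetches an element. *)
Lemma wp_for_each (St T : Type) (l : seq T) (f : T -> prog St unit)
    (Inv : seq T -> St -> nat -> Prop) s :
  Inv [::] s 0 ->
  (forall done x todo s k, l = done ++ x :: todo -> Inv done s k ->
    wp (f x) (fun _ s' k' => Inv (rcons done x) s' (k + (1 + k'))) s) ->
  wp (for_each l f) (fun _ s' k => Inv l s' k) s.
Proof.
move=> I0 IS.
suff gen todo done s1 k : l = done ++ todo -> Inv done s1 k ->
  wp (for_each todo f) (fun _ s' k' => Inv l s' (k + k')) s1.
  exact: (gen l [::] s 0).
elim: todo done s1 k => [|x todo IH] done s1 k El Ik /=.
  by apply: wp_ret; rewrite addn0 El cats0.
apply: wp_bind; apply: wp_call; apply: wp_bind.
apply: wp_conseq (IS _ _ _ _ _ El Ik) => _ s2 k2 I2.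
apply: wp_conseq (IH (rcons done x) s2 _ _ I2) => [_ s3 k3|].
  by rewrite -!addnA.
by rewrite cat_rcons.
Qed.

Lemma wp_collect (St T U : Type) (l : seq T) (f : T -> prog St (option U))
    (Inv : seq T -> seq U -> St -> nat -> Prop) s :
  Inv [::] [::] s 0 ->
  (forall done x todo r s k, l = done ++ x :: todo -> Inv done r s k ->
    wp (f x) (fun o s' k' =>
      Inv (rcons done x) (if o is Some y then rcons r y else r) s'
          (k + (1 + k'))) s) ->
  wp (collect l f) (fun r s' k => Inv l r s' k) s.
Proof.
move=> I0 IS.
suff gen todo done r s1 k : l = done ++ todo -> Inv done r s1 k ->
  wp (collect todo f) (fun r' s' k' => Inv l (r ++ r') s' (k + k')) s1.
  exact: (gen l [::] [::] s 0).
elim: todo done r s1 k => [|x todo IH] done r s1 k El Ik /=.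
  by apply: wp_ret; rewrite addn0 cats0 El cats0.
apply: wp_bind; apply: wp_call; apply: wp_bind.
apply: wp_conseq (IS _ _ _ _ _ _ El Ik) => o s2 k2 I2.
apply: wp_bind.
apply: wp_conseq (IH (rcons done x) _ s2 _ _ I2); last by rewrite cat_rcons.
move=> r3 s3 k3; rewrite /wp /=; case: o {I2} => [y|]; rewrite ?cat_rcons;
by rewrite addn0 -!addnA.
Qed.

Lemma wpP (St T : Type) (e : prog St T) Q s :
  wp e Q s -> exists x s' k, e s = (x, s', k) /\ Q x s' k.
Proof. by rewrite /wp; case: (e s) => -[x s'] k; exists x, s', k. Qed.

(** * Merge sort with grouping *)


(* The sum of min(n, 2^i) over 1 <= i <= e bounds how often a value of
   multiplicity n is handled when at most 2^e lists are merged. *)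
Fixpoint handled (e n : nat) : nat :=
  if e is e'.+1 then minn n (2 ^ e) + handled e' n else 0.

(** Up to i = [tl n] the terms are bounded by a geometric series with sum at most 2n; each of the
    remaining [e - tl n] terms is at most n. *)
Lemma handled_le e n : 0 < n -> handled e n <= n * (e - tl n) + 2 * n.
Proof.
move=> n_gt0.
have [lo hi] := andP (trunc_log_bounds (isT : 1 < 2) n_gt0).
have small d : d <= tl n -> handled d n <= 2 ^ d.+1.
  elim: d => [|d IH] //= dn.
  have {}IH := IH (ltnW dn).
  by rewrite [2 ^ d.+2]expnS mul2n -addnn leq_add // geq_minr.
elim: e => [|e IH] //.
case: (leqP e.+1 (tl n)) => en.
  apply: leq_trans (small _ en) _.
  rewrite (leq_trans _ (leq_addl _ _)) // expnS leq_mul2l /=.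
  by rewrite (leq_trans _ lo) // leq_exp2l.
rewrite subSn //= mulnS -addnA leq_add //; exact: geq_minl.
Qed.

Section Groups.
Context {F : set_functor} {A : Type} {flat : encoding F A}.
Context {I : refinement_interface flat} (M : implementation I) {C : finType}.

Local Notation value := {classic (F 'I_3)}.
Local Notation group := (value * seq C)%type.
Implicit Types (g : seq group) (gs : seq (seq group)).

Definition ltv : rel value := fun u v => if cmp3 M u v is Lt then true else false.

Lemma ltvP u v : reflect (cmp3 M u v = Lt) (ltv u v).
Proof. by rewrite /ltv; case: cmp3; constructor. Qed.

Lemma ltv_irr u : ltv u u = false.
Proof. by rewrite /ltv; have -> := (cmp3_eq M u u).2 erefl. Qed.

Lemma ltv_trans : transitive ltv.
Proof.
move=> v u w /ltvP uv /ltvP vw; apply/ltvP; exact: cmp3_trans uv vw.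
Qed.

Definition keys g : seq value := [seq h.1 | h <- g].

Definition sorted_groups g : bool :=
  pairwise ltv (keys g) && all (fun h : group => ~~ nilp h.2) g.

Definition pairs g : seq (value * C) :=
  flatten [seq [seq (h.1 : value, x) | x <- h.2] | h <- g].

Lemma pairs_cat g1 g2 : pairs (g1 ++ g2) = pairs g1 ++ pairs g2.
Proof. by rewrite /pairs map_cat flatten_cat. Qed.

Lemma uniq_keys g : sorted_groups g -> uniq (keys g).
Proof.
case/andP=> + _; elim: (keys g) => //= u l IH /andP[ul /IH->]; rewrite andbT.
by apply/negP => /(allP ul); rewrite ltv_irr.
Qed.

Lemma mem_keys g v x : (v, x) \in pairs g -> v \in keys g.
Proof.
case/flattenP=> _ /mapP[h hg ->] /mapP[y yh [-> _]].
exact: (map_f (fun h : group => h.1 : value) hg).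
Qed.

Lemma mem_pairs g h x : h \in g -> x \in h.2 -> (h.1, x) \in pairs g.
Proof.
move=> hg xh; apply/flattenP; exists [seq (h.1 : value, x) | x <- h.2].
  exact: (map_f (fun h : group => [seq (h.1 : value, x) | x <- h.2]) hg).
exact: map_f.
Qed.

Lemma merge_groups_cons u xs g1 v ys g2 :
  merge_groups M ((u, xs) :: g1) ((v, ys) :: g2) =
  let k := (1 + time_cmp3 M u v)%N in
  match cmp3 M u v with
  | Lt => let: (r, k') := merge_groups M g1 ((v, ys) :: g2) in
          ((u, xs) :: r, (k + k')%N)
  | Eq => let: (r, k') := merge_groups M g1 g2 in
          ((u, xs ++ ys) :: r, (k + k')%N)
  | Gt => let: (r, k') := merge_groups M ((u, xs) :: g1) g2 in
          ((v, ys) :: r, (k + k')%N)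
  end.
Proof. by []. Qed.

(** [O] will be the set of observed values, for which alone the comparison time is bounded; since
    merging creates no new keys, [O] is passed on from pass to pass. Every comparison uses up at
    least one group, hence the linear bound. *)
Lemma merge_groupsP (O : pred value) T g1 g2 :
  (forall u v, O u -> O v -> time_cmp3 M u v <= T) ->
  all O (keys g1) -> all O (keys g2) ->
  sorted_groups g1 -> sorted_groups g2 ->
  let: (g, k) := merge_groups M g1 g2 in
  [/\ sorted_groups g, keys g =i keys g1 ++ keys g2,
      perm_eq (pairs g) (pairs g1 ++ pairs g2) &
      k <= 1 + (size g1 + size g2) * T.+1].
Proof.
move=> OT.
elim: g1 g2 => [|[u xs] g1 IH1] g2.
  by case: g2 => [|[v ys] g2] /= _ O2 _ s2; split.
elim: g2 => [|[v ys] g2 IH2].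
  move=> /= O1 _ s1 _; split=> //; rewrite ?cats0 //.
move=> O1 O2 s1 s2.
have /andP[Ou O1'] := O1; have /andP[Ov O2'] := O2.
have s1' : sorted_groups g1.
  by case/andP: s1 => /= /andP[_ p1] /andP[_ a1]; apply/andP.
have s2' : sorted_groups g2.
  by case/andP: s2 => /= /andP[_ p2] /andP[_ a2]; apply/andP.
have tT := OT u v Ou Ov.
have head w zs (g : seq group) : ~~ nilp zs -> sorted_groups g ->
    all (ltv w) (keys g) -> sorted_groups ((w, zs) :: g).
  by move=> zs0 /andP[p a] wg; rewrite /sorted_groups /= wg p zs0.
have nx : ~~ nilp xs by case/andP: s1 => _ /= /andP[].
have ny : ~~ nilp ys by case/andP: s2 => _ /= /andP[].
have u1 : all (ltv u) (keys g1) by case/andP: s1 => /= /andP[].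
have v2 : all (ltv v) (keys g2) by case/andP: s2 => /= /andP[].
rewrite merge_groups_cons; case E: cmp3.
- have Euv : u = v := (cmp3_eq M u v).1 E.
  subst v.
  have := IH1 g2 O1' O2' s1' s2'; case: merge_groups => r k' [sr kr pr lek].
  split.
  + apply: head => //; first by rewrite /nilp size_cat addn_eq0 negb_and nx.
    by rewrite (eq_all_r kr) all_cat u1.
  + by move=> w; rewrite /= !inE kr !mem_cat inE; case: eqP; rewrite ?orbT.
  + rewrite /pairs /= map_cat -!catA perm_cat2l.
    rewrite perm_sym perm_catCA perm_cat2l perm_sym; exact: pr.
  + by move: lek tT; clear; rewrite /= !(addSn, addnS, mulSn, mulnS); lia.
- have uv : ltv u v by rewrite /ltv E.
  have := IH1 ((v, ys) :: g2) O1' O2 s1' s2; case: merge_groups => r k' [sr kr pr lek].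
  split.
  + apply: head => //; rewrite (eq_all_r kr) all_cat u1 /= uv /=.
    by apply: sub_all v2 => w; apply: ltv_trans.
  + by move=> w; rewrite /= !inE kr.
  + by rewrite /pairs /= -!catA perm_cat2l.
  + by move: lek tT; clear; rewrite /= !(addSn, addnS, mulSn, mulnS); lia.
- have vu : ltv v u by rewrite /ltv cmp3_sym E.
  have := IH2 O1 O2' s1 s2'; case: merge_groups => r k' [sr kr pr lek].
  split.
  + apply: head => //; rewrite (eq_all_r kr) all_cat v2 /= vu /= andbT.
    by apply: sub_all u1 => w; apply: ltv_trans.
  + move=> w; rewrite inE kr /= !inE !mem_cat !inE.
    by case: (w == v); rewrite ?orbT.
  + rewrite [pairs (_ :: r)]/pairs [pairs (_ :: g2)]/pairs /=.
    rewrite -/(pairs r) -/(pairs g2) perm_sym perm_catCA perm_cat2l perm_sym.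
    exact: pr.
  + by move: lek tT; clear; rewrite /= !(addSn, addnS, mulSn, mulnS); lia.
Qed.

Lemma merge_passP (O : pred value) T gs :
  (forall u v, O u -> O v -> time_cmp3 M u v <= T) ->
  all (fun g => all O (keys g)) gs -> all sorted_groups gs ->
  let: (gs', k) := merge_pass M gs in
  [/\ all (fun g => all O (keys g)) gs', all sorted_groups gs',
      perm_eq (pairs (flatten gs')) (pairs (flatten gs)),
      size gs' = uphalf (size gs) &
      k <= 1 + size gs + size (flatten gs) * T.+1].
Proof.
move=> OT; move: {2}(size gs) (leqnn (size gs)) => n.
elim: n gs => [|n IH] [|g1 [|g2 gs]] //= le_n; try by move=> O1 s1; split.
move=> /and3P[O1 O2 Os] /and3P[s1 s2 ss].
have := merge_groupsP OT O1 O2 s1 s2.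
case: merge_groups => g k [sg kg pg lek].
have := IH gs (ltnW le_n) Os ss.
case: merge_pass => r k' [Or sr pr szr lek'].
split.
- by rewrite /= Or andbT (eq_all_r kg) all_cat O1.
- by rewrite /= sg.
- by rewrite /= !pairs_cat catA perm_cat.
- by rewrite /= szr.
- by move: lek lek'; clear; rewrite /= !size_cat !mulnDl; lia.
Qed.

(** Serves for double counting: of groups by their keys, and of edges by their sources or
    targets. *)
Lemma size_sum_count (K : eqType) (l s : seq K) :
  uniq s -> {subset l <= s} -> size l = \sum_(v <- s) count_mem v l.
Proof.
move=> us; elim: l => [|a l IH] sub /=; first by rewrite big1_eq.
rewrite big_split /= -IH => [|x xl]; last by rewrite sub // inE xl orbT.
have -> : \sum_(v <- s) (a == v) = count_mem a s.
  by rewrite -sum1_count [RHS]big_mkcond; apply: eq_bigr => v _ /=; rewrite eq_sym; case: eqP.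
by rewrite count_uniq_mem // sub // mem_head.
Qed.

(* Every list contains a value at most once, and every occurrence of the value
   accounts for at least one of the states with this value. *)
Lemma size_flatten_groups gs (r : seq group) L :
  all sorted_groups gs -> sorted_groups r ->
  perm_eq (pairs r) (pairs (flatten gs)) -> size gs <= L ->
  size (flatten gs) <= \sum_(h <- r) minn (size h.2) L.
Proof.
move=> sgs sr pr gsL.
have cnt (g : seq group) v : all (fun h : group => ~~ nilp h.2) g ->
    count_mem v (keys g) <= count (fun q => q.1 == v) (pairs g).
  elim: g => //= h g IH /andP[h0 /IH {}IH].
  rewrite /pairs /= count_cat leq_add // count_map.
  case: eqP => [<-|//]; rewrite (eq_count (a2 := predT)) ?count_predT ?lt0n //.
  by move=> x /=; rewrite eqxx.
have nil_gs : all (fun h : group => ~~ nilp h.2) (flatten gs).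
  elim: (gs) sgs => //= g gs' IH /andP[/andP[_ a1] /IH a2].
  by rewrite all_cat a1.
have sub : {subset keys (flatten gs) <= keys r}.
  move=> v /mapP[h hgs ->].
  have := allP nil_gs _ hgs; case E: h.2 => [|x xs] // _.
  apply: (@mem_keys _ _ x); rewrite (perm_mem pr); apply: mem_pairs hgs _.
  by rewrite E mem_head.
rewrite -(size_map (fun h : group => h.1)) (size_sum_count (uniq_keys sr) sub).
rewrite big_map [X in X <= _]big_seq [X in _ <= X]big_seq.
apply: leq_sum => h hr; rewrite leq_min; apply/andP; split.
  apply: leq_trans (cnt _ _ nil_gs) _.
  (* The key of [h] occurs only once in [r], so all pairs with this key come from [h] itself. *)
  rewrite -(permP pr); have := uniq_keys sr.
  elim: (r) hr => //= h' r' IH; rewrite inE /pairs /= count_cat count_map.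
  case/orP=> [/eqP <-|hr] /andP[h'r' ur'].
    rewrite (eq_count (a2 := predT)) => [|x /=]; last by rewrite eqxx.
    rewrite count_predT -[X in _ <= X]addn0 leq_add2l leqn0 -leqn0 leqNgt -has_count.
    apply/hasPn => -[v x] /mem_keys /= vr; apply: contra h'r' => /eqP <- //.
  rewrite (eq_count (a2 := pred0)) => [|x /=]; first by rewrite count_pred0 IH.
  apply: contraNF h'r' => /eqP ->; exact: (map_f (fun h : group => h.1)).
apply: leq_trans gsL; elim: (gs) sgs => //= g gs' IH /andP[sg /IH {}IH].
rewrite /keys map_cat count_cat count_uniq_mem ?uniq_keys //.
by rewrite -(add1n (size gs')) leq_add // leq_b1.
Qed.

(** By [size_flatten_groups], a pass over at most 2^e lists handles a value of multiplicity n at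
    most min(n, 2^e) times, which is the top term of [handled]. It leaves at most 2^(e-1) lists for
    the induction. The overhead per list adds up to a geometric series, the summand [4 * 2 ^ e]. *)
Lemma merge_passesP (O : pred value) T gs d e :
  (forall u v, O u -> O v -> time_cmp3 M u v <= T) ->
  all (fun g => all O (keys g)) gs -> all sorted_groups gs ->
  size gs <= d -> size gs <= 2 ^ e ->
  let: (r, k) := merge_passes M d gs in
  [/\ sorted_groups r, perm_eq (pairs r) (pairs (flatten gs)) &
      k <= 1 + 4 * 2 ^ e + (\sum_(h <- r) handled e (size h.2)) * T.+1].
Proof.
move=> OT; elim: d gs e => [|d IH] [|g1 [|g2 gs]] e //=; try by move=> *; split.
  by move=> _ /andP[s1 _] _ _; rewrite cats0; split.
set gs0 := g1 :: g2 :: gs => O0 s0 szd sze.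
have := merge_passP OT (O0 : all (fun g => all O (keys g)) gs0) s0.
rewrite -[let: (g, _) := merge_groups M g1 g2 in _]/(merge_pass M gs0).
case: merge_pass => gs' k [O' s' p' sz' lek].
have lt1e : 1 < 2 ^ e by apply: leq_trans sze.
case: e => // e in sze lt1e *.
have := IH gs' e O' s'; case: merge_passes => r k' {}IH.
have {IH} [||sr pr lek'] := IH.
- by rewrite sz' /=; move: szd; clear; rewrite uphalf_half; lia.
- by rewrite sz' uphalf_half; move: sze; clear; rewrite expnS /=; lia.
have pr' := perm_trans pr p'.
split=> //.
have sz := size_flatten_groups (gs := gs0) s0 sr pr' sze.
have := leq_mul sz (leqnn T.+1).
rewrite [X in _ + X * _]big_split mulnDl /=.
move: lek lek' sze lt1e; rewrite -[(size gs).+2]/(size gs0).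
set X := \sum_(_ <- _) _; set Y := \sum_(_ <- _) _.
by rewrite expnS -[g1 ++ _]/(flatten gs0); clear; lia.
Qed.

(** Replacing [up_log] by [tl] costs at most one more term per value, which turns the 2 of
    [handled_le] into 3. *)
Lemma handled_sum_le (r : seq group) n :
  sorted_groups r -> \sum_(h <- r) size h.2 = n ->
  \sum_(h <- r) handled (up_log 2 n) (size h.2) <=
    \sum_(h <- r) size h.2 * (tl n - tl (size h.2)) + 3 * n.
Proof.
case/andP=> _ /allP nr sumr.
have r_gt0 h : h \in r -> 0 < size h.2 by move/nr; rewrite lt0n.
have eE : up_log 2 n <= (tl n).+1.
  by apply: up_log_min => //; apply/ltnW/trunc_log_ltn.
rewrite -[X in 3 * X]sumr big_distrr -big_split /= [X in X <= _]big_seq [X in _ <= X]big_seq.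
apply: leq_sum => h hr; apply: leq_trans (handled_le _ (r_gt0 _ hr)) _.
have : up_log 2 n - tl (size h.2) <= (tl n - tl (size h.2)).+1 by lia.
by move/(leq_mul (leqnn (size h.2))); rewrite mulnS [3 * _]mulSn addnA leq_add2r addnC.
Qed.

Lemma group_byP (O : pred value) T (vs : seq (value * C)) St :
  0 < T -> (forall u v, O u -> O v -> time_cmp3 M u v <= T) ->
  all O [seq vx.1 | vx <- vs] ->
  wp (group_by M vs) (fun r s k =>
    [/\ s = St, sorted_groups r, perm_eq (pairs r) vs &
     k <= 20 * T * (1 + size vs
       + \sum_(h <- r) size h.2 * (tl (size vs) - tl (size h.2)))]) St.
Proof.
move=> T_gt0 OT Ovs; rewrite /group_by.
set gs := (X in merge_passes _ _ X).
have szgs : size gs = size vs by rewrite size_map.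
have Ogs : all (fun g => all O (keys g)) gs.
  by move: Ovs; rewrite /gs; elim: (vs) => //= vx l IH /andP[-> /IH ->].
have sgs : all sorted_groups gs by rewrite /gs; elim: (vs) => //= vx l ->.
have pgs : pairs (flatten gs) = vs.
  by rewrite /gs; elim: (vs) => //= -[v x] l; rewrite /pairs /= => ->.
pose e := up_log 2 (size vs).
have sze : size gs <= 2 ^ e by rewrite szgs up_logP.
have := merge_passesP OT Ogs sgs _ sze.
rewrite szgs => /(_ (size vs) (leqnn _)).
case: merge_passes => r k [sr pr lek]; apply: wp_call.
rewrite pgs in pr; split=> //.
have sumr : \sum_(h <- r) size h.2 = size vs.
  rewrite -(perm_size pr) /pairs size_flatten /shape -map_comp sumnE big_map.
  by apply: eq_bigr => h _ /=; rewrite size_map.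
(* The summand 1 is for the empty list, where [e] is 0. *)
have pe : 2 ^ e <= 2 * size vs + 1.
  case: (ltnP 1 (size vs)) => v1; last first.
    have -> : e = 0 by apply/eqP; rewrite up_log_eq0 v1 orbT.
    by rewrite expn0; lia.
  have := up_log_gtn (isT : 1 < 2) v1; rewrite -/e.
  have e0 : 0 < e by rewrite up_log_gt0.
  by rewrite -{2}(prednK e0) expnS; lia.
have sumH := handled_sum_le sr sumr.
have := leq_mul sumH (leqnn T.+1).
move: lek pe; set X := \sum_(_ <- _) _; set Y := \sum_(_ <- _) _.
have : size vs <= T * size vs by rewrite leq_pmull.
have : Y <= T * Y by rewrite leq_pmull.
by move: (size vs) X Y (2 ^ e) T_gt0; clear => n X Y Z; lia.
Qed.

End Groups.

(** * Behavioural equivalence *)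

(** The default [z0] makes the factor total: it is its value outside the image of [f]. *)
Lemma factor_through (X Y Z : Type) (f : X -> Y) (g : X -> Z) (z0 : Z) :
  (forall x x', f x = f x' -> g x = g x') ->
  exists h : Y -> Z, g = fun x => h (f x).
Proof.
move=> fg.
exists (fun y => if pselect (exists x, f x = y) is left ex
                 then g (projT1 (cid ex)) else z0).
apply/funext => x; case: pselect => [ex|[]]; last by exists x.
by case: cid => x' /= /fg.
Qed.

Section Behaviour.
Context {F : set_functor}.

Lemma fmap_factor (X Y Z : Type) (f : X -> Y) (g : X -> Z) (z0 : Z) (t u : F X) :
  (forall x x', f x = f x' -> g x = g x') ->
  fmap f t = fmap f u -> fmap g t = fmap g u.
Proof.
by move=> /(factor_through z0)[h ->] tu; rewrite !(fmap_comp h f) tu.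
Qed.

Lemma behaviour_fmap (C Z : Type) (c : C -> F C) (g : C -> Z) (z0 : Z) x y :
  (forall x y, behaviourally_equivalent c x y -> g x = g y) ->
  behaviourally_equivalent c x y -> fmap g (c x) = fmap g (c y).
Proof.
move=> cg [D [d [h [hm hxy]]]].
have hg x' y' : h x' = h y' -> g x' = g y' by move=> ?; apply: cg; exists D, d, h.
by apply: (fmap_factor z0 hg); rewrite !hm hxy.
Qed.

Lemma quotient_behaviour (C : Type) (c : C -> F C) (f : C -> nat) :
  (forall x y, f x = f y -> fmap f (c x) = fmap f (c y)) ->
  forall x y, f x = f y -> behaviourally_equivalent c x y.
Proof.
move=> fP x y fxy.
(* The quotient coalgebra has all of [nat] as carrier; numbers that name no block get the structure
   of the block of [x]. *)
have [d dE] := factor_through (fmap f (c x)) fP.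
by exists nat, d, f; split=> // z; have /(congr1 (@^~ z)) := dE.
Qed.

(** Write B for the class of [q]. The map [h] into [nat + bool] keeps the value of [f] outside B and
    only the membership in [S] inside B; [f'] factors through [h]. Collapsing [bool] in [h] leaves a
    map that factors through [f], collapsing [nat] one that factors through chi_S^B, and zippability
    joins the two resulting equations. *)
Lemma zippable_split (C : eqType) (S : set C) (f : C -> nat) q q' (t u : F C) :
  zippable F -> (S `<=` [set y | f y = q])%classic ->
  fmap f t = fmap f u ->
  fmap (chi S [set y | f y = q]) t = fmap (chi S [set y | f y = q]) u ->
  let f' y := if `[< S y >] then q' else f y in fmap f' t = fmap f' u.
Proof.
move=> zF Sq ft chit /=.
pose h y : nat + bool := if f y == q then inr `[< S y >] else inl (f y).
have fh y y' : h y = h y' ->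
    (if `[< S y >] then q' else f y) = (if `[< S y' >] then q' else f y').
  rewrite /h; case: (eqVneq (f y) q) => [yq|yq];
    case: (eqVneq (f y') q) => [y'q|y'q] // [].
    by move=> ->; rewrite yq y'q.
  by move=> ->; case: asboolP => [/Sq/= E|_]; case: asboolP => [/Sq/= E'|_] //;
    [rewrite E eqxx in yq|rewrite E' eqxx in y'q].
apply: (fmap_factor q' fh); apply: zF; congr pair; rewrite -!fmap_comp.
  apply: (fmap_factor (inr tt) _ ft) => y y' fy.
  by rewrite /h fy; case: ifP.
apply: (fmap_factor (inl tt) _ chit) => y y'; rewrite /chi /h /=.
case: (asboolP (S y)) => [/Sq/= Sy|nSy]; case: (asboolP (S y')) => [/Sq/= Sy'|nSy'].
- by rewrite Sy Sy' eqxx.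
- by case: asboolP.
- by case: asboolP.
- case: (asboolP ([set y | f y = q]%classic y)) => /= yq;
  case: (asboolP ([set y | f y = q]%classic y')) => /= y'q // _.
  + by rewrite yq y'q eqxx.
  + by rewrite (introF eqP yq) (introF eqP y'q).
Qed.

End Behaviour.

(** * Weights and edges *)

Section Weights.
Context {F : set_functor} {A : Type} {flat : encoding F A} {W : Type}.
Context {init : F unit -> bag A -> W} {update : bag A -> W -> W * F 'I_3 * W}.
Context {w : forall X : Type, set X -> F X -> W}.
Hypothesis wF : weight_family flat init update w.

Lemma labels_into0 X (b : bag (A * X)) : labels_into b set0 = bag_of [::].
Proof.
rewrite /labels_into; congr bag_of.
by rewrite (eq_filter (a2 := pred0)) ?filter_pred0 // => e; apply: asboolF.
Qed.

Lemma update_nil X (t : F X) (B : set X) :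
  update (bag_of [::]) (w B t) = (w set0 t, fmap (chi set0 B) t, w B t).
Proof.
by have [_ /(_ set0 B (@sub0set _ B))] := wF t; rewrite labels_into0 setD0.
Qed.

(** The calls of [update] for [S] and for the empty set have the same arguments, hence the same
    results. *)
Lemma no_labels X (t : F X) (S B : set X) :
  (S `<=` B)%classic -> labels_into (flat t) S = bag_of [::] ->
  fmap (chi S B) t = fmap (chi set0 B) t /\ w (B `\` S)%classic t = w B t.
Proof.
move=> SB S0; have [_ /(_ S B SB)] := wF t.
by rewrite S0 update_nil => -[_ <- <-].
Qed.

End Weights.

Lemma bag_of_perm (T : Type) (s1 s2 : seq {classic T}) :
  perm_eq s1 s2 -> bag_of s1 = bag_of s2.
Proof. by move=> /eq_seq_msetP. Qed.

Lemma bag_size_of (T : Type) (s : seq T) : bag_size (bag_of s) = size s.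
Proof. exact: perm_size (@perm_eq_seq_mset {classic T} s). Qed.

Section Edges.
Context {F : set_functor} {A : Type} {flat : encoding F A} {C : finType}.
Variable c : C -> F C.

Local Notation edgeT := {classic (edge A C)}.
Local Notation E := (edges (flat := flat) c : seq edgeT).

Lemma edge_ids : [seq edge_id e | e <- E] = iota 0 (size E).
Proof.
rewrite /edges -map_comp size_map size_zip size_iota minnn.
set es := flatten _.
by rewrite -[RHS](@unzip1_zip _ _ (iota 0 (size es)) es) ?size_iota //.
Qed.

Lemma edge_id_inj : {in E &, injective (@edge_id A C)}.
Proof.
move=> e e' eE e'E ee'.
have uid : uniq [seq edge_id e | e <- E] by rewrite edge_ids iota_uniq.
pose i := index e E; pose i' := index e' E.
have [li li'] : i < size E /\ i' < size E by rewrite !index_mem.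
have := nth_uniq 0 _ _ uid; rewrite size_map => /(_ i i' li li').
rewrite !(nth_map (e : edgeT)) // !nth_index // ee' eqxx => /esym/eqP ii'.
by rewrite -(nth_index e eE) -/i ii' nth_index.
Qed.

Lemma edges_from x :
  [seq (edge_lab e, edge_tgt e) | e <- E & edge_src e == x] = elems (flat (c x)).
Proof.
rewrite /edges; set es := flatten _.
have -> : [seq (edge_lab e, edge_tgt e) |
    e <- [seq Edge ie.1 ie.2.1 ie.2.2.1 ie.2.2.2 | ie <- zip (iota 0 (size es)) es]
    & edge_src e == x] = [seq p.2 | p <- es & p.1 == x].
  transitivity [seq p.2 | p <- unzip2 (zip (iota 0 (size es)) es) & p.1 == x];
    last by rewrite unzip2_zip ?size_iota.
  rewrite /unzip2; elim: (zip _ _) => //= -[i [y [a z]]] l IH /=.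
  by case: eqP => _ /=; rewrite IH.
rewrite /es; have := mem_enum C x; have := enum_uniq C.
elim: (enum C) => //= y l IH /andP[yl ul]; rewrite inE filter_cat map_cat.
have flt : forall z, [seq p.2 | p <- [seq (z, e) | e <- elems (flat (c z))] & p.1 == x]
     = if z == x then elems (flat (c x)) else [::].
  move=> z; case: eqP => [->|zx].
    rewrite filter_map (eq_filter (a2 := predT)) ?filter_predT -?map_comp ?map_id //.
    by move=> e /=; rewrite eqxx.
  rewrite filter_map (eq_filter (a2 := pred0)) ?filter_pred0 //.
  by move=> e /=; apply/eqP.
have nil : x \notin l -> [seq p.2 | p <- [seq (x, e) | x <- l, e <- elems (flat (c x))] & p.1 == x] = [::].
  elim: (l) => //= z l' IHl; rewrite inE negb_or filter_cat map_cat => /andP[xz /IHl ->].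
  by rewrite flt eq_sym (negPf xz).
rewrite flt eq_sym; case: eqP => [xy _|_ /= xl]; last by rewrite IH.
by rewrite nil ?cats0 // -xy.
Qed.

Lemma size_edges : size E = num_edges flat c.
Proof.
rewrite /edges size_map size_zip size_iota minnn size_allpairs_dep.
by rewrite sumnE big_map big_enum.
Qed.

Definition edges_into (ys : seq C) : seq edgeT :=
  [seq e <- E | edge_tgt e \in ys].

Lemma label_bag_into ys x (es : seq edgeT) :
  perm_eq es [seq e <- edges_into ys | edge_src e == x] ->
  label_bag es = labels_into (flat (c x)) [set y | y \in ys].
Proof.
move=> pes; rewrite /label_bag /labels_into -edges_from.
transitivity (bag_of [seq edge_lab e | e <- [seq e <- edges_into ys | edge_src e == x]]).
  exact/bag_of_perm/(perm_map (fun e : edgeT => edge_lab e : {classic A})).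
congr bag_of; rewrite /edges_into; elim: (edges c) => //= e l IH.
case sx: (edge_src e == x); case: ifP => /= ty.
- by rewrite sx /= asboolb ty /= IH.
- by rewrite asboolb ty IH.
- by rewrite sx.
- exact: IH.
Qed.

Lemma label_bag_all x (es : seq edgeT) :
  perm_eq es [seq e <- E | edge_src e == x] ->
  label_bag es = labels (flat (c x)).
Proof.
move=> pes; rewrite /label_bag /labels -edges_from -map_comp.
exact/bag_of_perm/(perm_map (fun e : edgeT => edge_lab e : {classic A})).
Qed.

(** The order is reversed because [add_edge] pushes edges to the front; thus [pred_edges] is equal
    to this list and not only a permutation of it. *)
Definition edges_to (y : C) : seq edgeT := [seq e <- rev E | edge_tgt e == y].

Lemma perm_edges_into (ys : seq C) : uniq ys ->
  perm_eq (flatten [seq edges_to y | y <- ys]) (edges_into ys).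
Proof.
elim: ys => [|y ys IH] /=.
  by rewrite /edges_into (eq_filter (a2 := pred0)) ?filter_pred0.
case/andP=> yys /IH {}IH.
rewrite -(perm_cat2l (edges_to y)) in IH.
apply: perm_trans IH _.
have pyy : perm_eq (edges_to y ++ edges_into ys)
          ([seq e <- edges_into (y :: ys) | edge_tgt e == y]
           ++ [seq e <- edges_into (y :: ys) | edge_tgt e != y]).
  apply: perm_cat.
    rewrite /edges_to filter_rev perm_rev; apply/permP => p; congr count.
    rewrite /edges_into; elim: (edges c) => //= e l IHl.
    by case ty: (edge_tgt e == y); rewrite inE ty /= ?ty IHl //; case: ifP; rewrite /= ?ty.
  apply/permP => p; congr count.
  rewrite /edges_into; elim: (edges c) => //= e l IHl.
  rewrite inE; case: (eqVneq (edge_tgt e) y) => [ty|ty] /=.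
    by rewrite ty (negPf yys) eqxx.
  by case: ifP; rewrite /= ?ty IHl.
by apply: perm_trans pyy _; apply/permEl/perm_filterC.
Qed.

End Edges.

(** * The partitions P and Q *)

Section Partitions.
Context {F : set_functor} {A W : Type} {C : finType}.
Implicit Types (s : memory F A W C) (D : C -> bool).

(** [D] holds of the states that currently belong to a block. It is not everything while the initial
    blocks are being created, and between the removal of states from a block and the creation of
    their new one. *)
Record partitions D s : Prop := Partitions {
  pmem_uniq : forall b, b < pnum s -> uniq (pmem s b);
  pmem_nil : forall b, b < pnum s -> ~~ nilp (pmem s b);
  mem_pmem : forall b x, b < pnum s -> (x \in pmem s b) = D x && (pblk s x == b);
  pblk_lt : forall x, D x -> pblk s x < pnum s;
  qmem_uniq : forall q, q < qnum s -> uniq (qmem s q);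
  mem_qmem : forall q b, q < qnum s ->
    (b \in qmem s q) = (b < pnum s) && (qblk s b == q);
  qblk_lt : forall b, b < pnum s -> qblk s b < qnum s;
  work_uniq : uniq (work s);
  mem_work : forall q, (q \in work s) = (q < qnum s) && (1 < size (qmem s q))
}.

Lemma eq_partitions D D' s : D =1 D' -> partitions D s -> partitions D' s.
Proof. by move=> /funext ->. Qed.

Definition qcls s (x : C) : nat := qblk s (pblk s x).

(** The fields that [new_block] and [split_off] leave alone. *)
Definition rest s :=
  (qnum s, pred_edges s, to_sub s, last_w s, cnum s, cell s, mark s, touched s).

End Partitions.

Section Blocks.
Context {F : set_functor} {A : Type} {flat : encoding F A}.
Context {I : refinement_interface flat} {C : finType}.
Local Notation store := (memory F A (weight I) C).
Implicit Types (s : store) (D : C -> bool).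

Lemma for_each_pblk (xs : seq C) i s (Q : unit -> store -> nat -> Prop) :
  Q tt (set_pblk (fun x => if x \in xs then i else pblk s x) s) (2 * size xs) ->
  wp (for_each xs (fun x => put_pblk x i)) Q s.
Proof.
move=> H.
apply: (@wp_conseq _ _ _ (fun _ s' k =>
  s' = set_pblk (fun x => if x \in xs then i else pblk s x) s /\ k = 2 * size xs)).
  by move=> [] s' k [-> ->].
apply: (wp_for_each (Inv := fun done s' k =>
  s' = set_pblk (fun x => if x \in done then i else pblk s x) s /\ k = 2 * size done)).
  by case: s {H}.
move=> done x todo s' k _ [-> ->]; apply: wp_write; split.
  case: s {H} => *; congr Memory; apply/funext => y /=.
  by rewrite /set_at mem_rcons inE; case: eqP.
by rewrite size_rcons; lia.
Qed.

Lemma new_blockP D s q (xs : seq C) :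
  partitions D s -> uniq xs -> ~~ nilp xs -> (forall x, x \in xs -> ~~ D x) ->
  q < qnum s ->
  wp (new_block q xs) (fun _ s' k =>
    [/\ partitions (fun x => D x || (x \in xs)) s', rest s' = rest s,
        pnum s' = (pnum s).+1,
        (forall x, pblk s' x = if x \in xs then pnum s else pblk s x)
          /\ (forall b, qblk s' b = if b == pnum s then q else qblk s b) &
        k <= 8 + 2 * size xs]) s.
Proof.
case: s => pn pb pm qn qb qm wk pe ts lw cn cl mk td.
case=> /= Hpu Hpn Hpm Hpl Hqu Hqm Hql Hwu Hwm ux nx xD qlt.
rewrite /new_block.
apply: wp_bind; apply: wp_read; apply: wp_bind; apply: wp_write.
apply: wp_bind; apply: wp_write; apply: wp_bind; apply: for_each_pblk.
apply: wp_bind; apply: wp_write; apply: wp_bind; apply: wp_read.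
apply: wp_bind; apply: wp_write => /=.
have pnq : pn \notin qm q by rewrite Hqm // ltnn.
have common wk' : uniq wk' ->
   (forall q', (q' \in wk') = (q' < qn) && (1 < size (set_at qm q (pn :: qm q) q'))) ->
   partitions (fun x => D x || (x \in xs))
     (Memory pn.+1 (fun x => if x \in xs then pn else pb x) (set_at pm pn xs) qn
        (set_at qb pn q) (set_at qm q (pn :: qm q)) wk' pe ts lw cn cl mk td : store).
  move=> uwk' mwk'; split=> //=.
  - by move=> b; rewrite /set_at ltnS leq_eqVlt; case: eqP => //= _; apply: Hpu.
  - by move=> b; rewrite /set_at ltnS leq_eqVlt; case: eqP => //= _; apply: Hpn.
  - move=> b x; rewrite /set_at ltnS leq_eqVlt; case: eqP => [-> _|bpn /= blt].
      case xx: (x \in xs); first by rewrite orbT eqxx.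
      rewrite orbF; case Dx: (D x) => //=.
      by rewrite ltn_eqF // Hpl.
    rewrite Hpm //; case xx: (x \in xs); last by rewrite orbF.
    rewrite (negPf (xD _ xx)) /=; apply/esym/eqP => pnb; exact: bpn.
  - move=> x; case: (x \in xs); first by rewrite ltnS.
    by rewrite orbF => /Hpl; rewrite ltnS; apply: ltnW.
  - move=> q' q'lt; rewrite /set_at; case: eqP => [_|_]; last exact: Hqu.
    by rewrite /= pnq Hqu.
  - move=> q' b q'lt; rewrite /set_at; case: (eqVneq q' q) => [->|q'q].
      rewrite inE Hqm // ltnS; case: (eqVneq b pn) => [->|bpn] /=.
        by rewrite leqnn eqxx.
      by rewrite [in RHS]leq_eqVlt (negPf bpn).
    rewrite Hqm // ltnS; case: (eqVneq b pn) => [->|bpn] /=.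
      by rewrite ltnn (eq_sym q) (negPf q'q) andbF.
    by rewrite [in RHS]leq_eqVlt (negPf bpn).
  - by move=> b; rewrite /set_at ltnS leq_eqVlt; case: eqP => //= _; apply: Hql.
(* A block of Q enters the worklist at the moment when it receives its second block of P. *)
apply: wp_when => [/eqP sz1|sz1].
  apply: wp_bind; apply: wp_read; apply: wp_write => /=.
  split=> //; last lia.
  apply: common => [|q'] /=; first by rewrite Hwm Hwu sz1 andbF.
  rewrite inE Hwm /set_at; case: (eqVneq q' q) => [->|//] /=.
  by rewrite qlt sz1.
split=> //; last by clear; lia.
apply: common => // q'; rewrite Hwm /set_at; case: (eqVneq q' q) => [->|//].
by move: sz1; rewrite /=; case: (size (qm q)) => [|[|]].
Qed.

Lemma for_each_rem (xs : seq C) b s (Q : unit -> store -> nat -> Prop) :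
  uniq (pmem s b) ->
  Q tt (set_pmem (set_at (pmem s) b [seq y <- pmem s b | y \notin xs]) s)
    (3 * size xs) ->
  wp (for_each xs (fun x =>
    let* ys := read (fun s => pmem s b) in put_pmem b (rem x ys))) Q s.
Proof.
move=> us H.
pose fin l := set_pmem (set_at (pmem s) b [seq y <- pmem s b | y \notin (l : seq C)]) s.
apply: (@wp_conseq _ _ _ (fun _ s' k => s' = fin xs /\ k = 3 * size xs)).
  by move=> [] s' k [-> ->].
apply: (wp_for_each (Inv := fun done s' k => s' = fin done /\ k = 3 * size done)).
  rewrite /fin filter_predT; case: s {us H fin} => *; split=> //=; congr Memory.
  by apply/funext => b'; rewrite /set_at; case: eqP => [->|].
move=> done x todo s' k _ [-> ->]; apply: wp_bind; apply: wp_read.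
apply: wp_write; split; last by rewrite size_rcons; lia.
rewrite /fin; case: s {H fin} us => /= *; congr Memory.
apply/funext => b'; rewrite /set_at eqxx; case: eqP => // _.
rewrite rem_filter ?filter_uniq // -filter_predI; apply: eq_filter => y /=.
by rewrite mem_rcons inE negb_or.
Qed.

(** The state [z] stays behind and keeps the block [b] from becoming empty. *)
Lemma split_offP s b (xs : seq C) z :
  partitions predT s -> b < pnum s -> uniq xs -> ~~ nilp xs ->
  {subset xs <= pmem s b} -> z \in pmem s b -> z \notin xs ->
  wp (split_off b xs) (fun _ s' k =>
    [/\ partitions predT s', rest s' = rest s,
        (forall x, pblk s' x = if x \in xs then pnum s else pblk s x),
        (forall x, qcls s' x = qcls s x) & pnum s <= pnum s' /\ k <= 14 * size xs]) s.
Proof.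
move=> Ps bs ux nx xb zb zx; rewrite /split_off.
apply: wp_bind; apply: for_each_rem; first exact: (pmem_uniq Ps).
apply: wp_bind; apply: wp_read.
set s1 := set_pmem _ _.
have Es1 : [/\ pnum s1 = pnum s, pblk s1 = pblk s,
    pmem s1 = set_at (pmem s) b [seq y <- pmem s b | y \notin xs],
    qnum s1 = qnum s & [/\ qblk s1 = qblk s, qmem s1 = qmem s, work s1 = work s &
    rest s1 = rest s]].
  by rewrite /s1; case: (s).
have [Epn Epb Epm Eqn [Eqb Eqm Ewk Er]] := Es1.
have P1 : partitions (fun x => x \notin xs) s1.
  case: Ps => Hpu Hpn Hpm Hpl Hqu Hqm Hql Hwu Hwm.
  split; rewrite ?Epn ?Epb ?Epm ?Eqn ?Eqb ?Eqm ?Ewk //.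
  - by move=> b' b'lt; rewrite /set_at; case: eqP => _; rewrite ?filter_uniq ?Hpu.
  - move=> b' b'lt; rewrite /set_at; case: eqP => _; last exact: Hpn.
    rewrite /nilp size_filter -lt0n -has_count; apply/hasP; by exists z.
  - move=> b' x b'lt; rewrite /set_at; case: (eqVneq b' b) => [->|b'b].
      by rewrite mem_filter Hpm.
    rewrite Hpm //=; case xx: (x \in xs) => //=.
    have := xb _ xx; rewrite Hpm //= => /eqP ->.
    by rewrite eq_sym (negPf b'b).
  - by move=> x _; apply: Hpl.
have bq : qblk s1 b < qnum s1 by rewrite Eqb Eqn (qblk_lt Ps).
apply: wp_conseq (new_blockP P1 ux nx _ bq); last by move=> x xx; rewrite negbK.
move=> [] s' k [P' Er' Epn' [Epb' Eqb'] lek]; split.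
- by apply: eq_partitions P' => x; rewrite /= orNb.
- by rewrite Er'.
- by move=> x; rewrite Epb' Epn Epb.
- move=> x; rewrite /qcls Epb' Eqb' Epn Epb Eqb.
  case xx: (x \in xs).
    by rewrite eqxx; have := xb _ xx; rewrite (mem_pmem Ps) //= => /eqP ->.
  by rewrite ltn_eqF // (pblk_lt Ps).
- rewrite Epn' Epn; split=> //.
  by move: nx lek; rewrite /nilp; lia.
Qed.

End Blocks.

(** * Potentials *)

Definition class_size (C : finType) (f : C -> nat) (x : C) : nat :=
  #|[pred y | f y == f x]|.

Definition potential (C : finType) (g f : C -> nat) : nat :=
  \sum_x g x * tl (class_size f x).

Section Entropy.
Context {F : set_functor} {A : Type} {flat : encoding F A}.
Context {I : refinement_interface flat} (M : implementation I) {C : finType}.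
Local Notation value := {classic (F 'I_3)}.
Local Notation group := (value * seq C)%type.

Lemma mem_group (r : seq group) h y :
  sorted_groups M r -> h \in r -> (y \in h.2) = ((h.1, y) \in pairs r).
Proof.
move=> sr hr; apply/idP/idP => [|/flattenP[_ /mapP[h' h'r ->] /mapP[z zh' []]]].
  exact: mem_pairs.
move=> eh ->; suff -> : h = h' by [].
have ur := uniq_keys sr.
have [i ir hi] := nthP h hr; have [j jr hj] := nthP h h'r.
have := nth_uniq (h.1 : value) _ _ ur; rewrite /keys size_map => /(_ i j ir jr).
rewrite !(nth_map h) // hi hj eh eqxx => /esym/eqP ij.
by rewrite -hi -hj ij.
Qed.

Lemma uniq_group (r : seq group) h :
  uniq (pairs r) -> h \in r -> uniq h.2.
Proof.
elim: r => //= h' r IH; rewrite /pairs /= cat_uniq => /and3P[u1 _ u2].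
rewrite inE => /orP[/eqP ->|/IH]; last exact.
exact: map_uniq u1.
Qed.

(* The cost of grouping is paid for by the states moving to smaller blocks. *)
Lemma grouping_entropy (val : C -> value) (f f' : C -> nat) b (r : seq group)
    (vs : seq (value * C)) :
  (forall x y, f' x = f' y -> f x = f y /\ (f x = b -> val x = val y)) ->
  sorted_groups M r -> perm_eq (pairs r) vs -> uniq [seq vx.2 | vx <- vs] ->
  (forall v x, (v, x) \in vs -> v = val x /\ f x = b) ->
  (forall v x y, (v, x) \in vs -> f y = b -> val y = v -> (v, y) \in vs) ->
  potential (fun=> 1) f'
    + \sum_(h <- r) size h.2 * (tl (size vs) - tl (size h.2))
  <= potential (fun=> 1) f.
Proof.
move=> ff' sr pr uvs vsP vsC.
pose d x := tl (class_size f x) - tl (class_size f' x).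
have le_size x : class_size f' x <= class_size f x.
  by apply/subset_leq_card/fintype.subsetP => y; rewrite !inE => /eqP /ff'[->].
have -> : potential (fun=> 1) f = potential (fun=> 1) f' + \sum_x d x.
  rewrite /potential -big_split /=; apply: eq_bigr => x _.
  by rewrite !mul1n subnKC // leq_trunc_log.
rewrite leq_add2l.
have -> : \sum_x d x = \sum_(x | x \in [seq vx.2 | vx <- vs]) d x
                     + \sum_(x | x \notin [seq vx.2 | vx <- vs]) d x.
  by rewrite (bigID (fun x => x \in [seq vx.2 | vx <- vs])).
apply: leq_trans (leq_addr _ _).
rewrite -big_uniq //= big_map -(perm_big _ pr) /= /pairs big_flatten big_map.
rewrite big_seq [X in _ <= X]big_seq; apply: leq_sum => h hr.
rewrite big_map /= -sum1_size big_distrl /= big_seq [X in _ <= X]big_seq.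
(* The old class of [x] contains all states of [vs], and its new class lies inside its group. *)
apply: leq_sum => x xh; rewrite mul1n sum1_size; apply: leq_sub.
  apply: leq_trunc_log; rewrite -(size_map snd) -(card_uniqP uvs).
  apply/subset_leq_card/fintype.subsetP => y /mapP[[v y'] yvs /= ->].
  rewrite inE (vsP _ _ yvs).2.
  have : (h.1, x) \in vs by rewrite -(perm_mem pr) -(mem_group _ sr hr).
  by move/vsP => [_ ->].
have hx : (h.1, x) \in vs by rewrite -(perm_mem pr) -(mem_group _ sr hr).
have [vx fx] := vsP _ _ hx.
apply: leq_trunc_log; apply: leq_trans (card_size h.2).
apply/subset_leq_card/fintype.subsetP => y; rewrite inE => /eqP yx.
have [fy vy] := ff' _ _ yx.
rewrite fx in fy; rewrite (mem_group _ sr hr) (perm_mem pr).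
by apply: (vsC _ x) => //; rewrite vy.
Qed.

End Entropy.

(** * Splitting a block of P *)

Section Splitting.
Context {F : set_functor} {A : Type} {flat : encoding F A}.
Context {I : refinement_interface flat} {C : finType}.
Local Notation value := {classic (F 'I_3)}.
Local Notation group := (value * seq C)%type.
Local Notation store := (memory F A (weight I) C).

Definition states (l : seq group) : seq C := flatten [seq h.2 | h <- l].

Lemma mem_states (l : seq group) x :
  reflect (exists2 h, h \in l & x \in h.2) (x \in states l).
Proof.
apply: (iffP flattenP) => [[_ /mapP[h hl ->] xh]|[h hl xh]]; first by exists h.
by exists h.2 => //; apply: map_f.
Qed.

(** Unmoved states stay together whatever their values, so equality of values is asked for only if
    one of the two states is moved. The statement thus covers both the case that the states of value
    [v0] remain and the case that the first group does. *)
Lemma split_groupsP (val : C -> value) (s : store) b z (l : seq group) :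
  partitions predT s -> b < pnum s -> uniq [seq h.1 | h <- l] ->
  (forall h, h \in l -> [/\ uniq h.2, ~~ nilp h.2 &
     forall y, (y \in h.2) = (pblk s y == b) && (val y == h.1)]) ->
  pblk s z = b -> z \notin states l ->
  wp (for_each l (fun h => split_off b h.2)) (fun _ s' k =>
    [/\ partitions predT s', rest s' = rest s,
        (forall x, qcls s' x = qcls s x),
        (forall x, x \notin states l -> pblk s' x = pblk s x)
          /\ (forall x y, pblk s' x = pblk s' y <-> pblk s x = pblk s y /\
              ((x \in states l) || (y \in states l) -> val x = val y)) &
        pnum s <= pnum s' /\ k <= 15 * size (states l)]) s.
Proof.
move=> Ps bs ul lP zb zl.
apply: (wp_for_each (Inv := fun (done : seq group) s' k =>
    [/\ partitions predT s', rest s' = rest s,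
        (forall x, qcls s' x = qcls s x),
        (forall x, x \notin states done -> pblk s' x = pblk s x)
          /\ (forall x y, pblk s' x = pblk s' y <-> pblk s x = pblk s y /\
              ((x \in states done) || (y \in states done) -> val x = val y)) &
        pnum s <= pnum s' /\ k <= 15 * size (states done)])).
  by split=> //; split=> // x y; split=> [|[]].
move=> done h todo s' k El [P' Er Eq [Ep Ei] [Epn lek]].
have hl : h \in l by rewrite El mem_cat mem_head orbT.
have [uh nh hP] := lP _ hl.
have disj x : x \in h.2 -> x \notin states done.
  rewrite hP => /andP[_ /eqP xh]; apply/negP => /mem_states[h' h'd xh'].
  have h'l : h' \in l by rewrite El mem_cat h'd.
  move: xh'; have [_ _ ->] := lP _ h'l; rewrite xh => /andP[_ /eqP hh'].
  move: ul; rewrite El map_cat cat_uniq => /and3P[_ /hasPn/(_ h.1)].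
  rewrite /= mem_head => /(_ isT) /negP[].
  by rewrite hh'; apply: (map_f (fun h : group => h.1)).
have zd : z \notin states done.
  by apply: contra zl => /mem_states[h' h'd zh']; apply/mem_states; exists h';
     rewrite // El mem_cat h'd.
have bs' : b < pnum s' by apply: leq_trans Epn.
have zh : z \notin h.2.
  by apply: contra zl => zh; apply/mem_states; exists h.
have xb : {subset h.2 <= pmem s' b}.
  move=> x xh; rewrite (mem_pmem P') //= Ep ?disj //.
  by move: xh; rewrite hP => /andP[].
have zb' : z \in pmem s' b by rewrite (mem_pmem P') //= Ep // zb.
apply: wp_conseq (split_offP P' bs' uh nh xb zb' zh).
move=> [] s'' k' [P'' Er'' Ep'' Eq'' [Epn'' lek']].
have statesE x : (x \in states (rcons done h)) = (x \in states done) || (x \in h.2).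
  by rewrite /states map_rcons -cats1 flatten_cat /= cats0 mem_cat.
split=> //.
- by rewrite Er''.
- by move=> x; rewrite Eq''.
- split=> [x|x y].
    by rewrite statesE negb_or Ep'' => /andP[xd /negPf ->]; apply: Ep.
  have aux x' y' : x' \in h.2 -> y' \notin h.2 ->
      ~ (pblk s x' = pblk s y' /\ val x' = val y').
    rewrite !hP => /andP[/eqP xb' /eqP xh'] yh' [pxy vxy]; case/negP: yh'.
    by rewrite -pxy xb' -vxy xh' !eqxx.
  have lt x' : pblk s' x' < pnum s' by apply: (pblk_lt P').
  rewrite !Ep'' !statesE.
  case xh: (x \in h.2); case yh: (y \in h.2).
  + split=> // _; move: xh yh; rewrite !hP => /andP[/eqP -> /eqP ->].
    by case/andP=> /eqP -> /eqP ->.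
  + split=> [yE|[pxy /(_ _)/= vxy]]; first by have := lt y; rewrite -yE ltnn.
    by case: (aux x y xh (negbT yh)); split=> //; apply: vxy; rewrite orbT.
  + split=> [yE|[pxy /(_ _)/= vxy]]; first by have := lt x; rewrite yE ltnn.
    case: (aux y x yh (negbT xh)); split=> //.
    by apply/esym/vxy; rewrite !orbT.
  + by rewrite !orbF; apply: Ei.
- split; first exact: leq_trans Epn Epn''.
  move: nh lek lek'; rewrite /states map_rcons -cats1 flatten_cat size_cat /= cats0 /nilp.
  by clear; lia.
Qed.

End Splitting.

(** * The memory cells *)

Section Cells.
Context {F : set_functor} {A : Type} {flat : encoding F A}.
Context {I : refinement_interface flat} {C : finType}.
Variable c : C -> F C.
Variable w : forall X : Type, set X -> F X -> weight I.
Local Notation store := (memory F A (weight I) C).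
Local Notation edgeT := {classic (edge A C)}.
Local Notation E := (edges (flat := flat) c : seq edgeT).

(* [cls x] is the partition to which the cells of the edges from x refer:
   while P is refined, only some of the states have been updated. *)
Record cells_ok (cls : C -> C -> nat) (s : store) : Prop := CellsOk {
  last_w_lt : forall e, e \in E -> last_w s (edge_id e) < cnum s;
  cell_w : forall e, e \in E -> cell s (last_w s (edge_id e)) =
    Some (w [set y | cls (edge_src e) y = cls (edge_src e) (edge_tgt e)]%classic
            (c (edge_src e)));
  last_w_eq : forall e e', e \in E -> e' \in E ->
    last_w s (edge_id e) = last_w s (edge_id e') <->
    edge_src e = edge_src e' /\
    cls (edge_src e) (edge_tgt e) = cls (edge_src e) (edge_tgt e')
}.

Lemma eq_cells_ok cls s s' :
  last_w s' = last_w s -> cnum s' = cnum s -> cell s' = cell s ->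
  cells_ok cls s -> cells_ok cls s'.
Proof. by move=> El En Ec [H1 H2 H3]; split; rewrite ?El ?En ?Ec. Qed.

Lemma for_each_last_w (es : seq edgeT) j (s : store) (Q : unit -> store -> nat -> Prop) :
  Q tt (set_last_w (fun i => if i \in [seq edge_id e | e <- es] then j
                             else last_w s i) s) (2 * size es) ->
  wp (for_each es (fun e => put_last_w e j)) Q s.
Proof.
move=> H.
pose fin (l : seq edgeT) := set_last_w (fun i =>
  if i \in [seq edge_id e | e <- l] then j else last_w s i) s.
apply: (@wp_conseq _ _ _ (fun _ s' k => s' = fin es /\ k = 2 * size es)).
  by move=> [] s' k [-> ->].
apply: (wp_for_each (Inv := fun done s' k => s' = fin done /\ k = 2 * size done)).
  by rewrite /fin; case: s {H fin}.
move=> done x todo s' k _ [-> ->]; apply: wp_write; split.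
  rewrite /fin; case: s {H fin} => *; congr Memory; apply/funext => i /=.
  by rewrite /set_at map_rcons mem_rcons inE; case: eqP.
by rewrite size_rcons; lia.
Qed.

End Cells.

(** * Regrouping the states of a block *)

Section Regroup.
Context {F : set_functor} {A : Type} {flat : encoding F A}.
Context {I : refinement_interface flat} (M : implementation I) {C : finType}.
Variable c : C -> F C.
Variable w : forall X : Type, set X -> F X -> weight I.
Hypothesis wF : weight_family flat (init I) (@update _ _ _ I) w.
Variable T : nat.
Hypothesis T_gt0 : 0 < T.
Hypothesis time_updateP : forall x (S B : set C), (S `<=` B)%classic ->
  time_update M (labels_into (flat (c x)) S) (w B (c x))
    <= T * maxn 1 (bag_size (labels_into (flat (c x)) S)).
Hypothesis time_cmp3P : forall u v, observations c u -> observations c v ->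
  time_cmp3 M u v <= T.

Local Notation value := {classic (F 'I_3)}.
Local Notation group := (value * seq C)%type.
Local Notation store := (memory F A (weight I) C).
Local Notation edgeT := {classic (edge A C)}.
Local Notation E := (edges (flat := flat) c : seq edgeT).

(* Q is split by replacing its block q, which contains the states ys, by
   the block ys, named q', and the rest, which keeps the name q. *)
Variables (ys : seq C) (oq : C -> nat) (q q' : nat).
Hypothesis ys_q : forall y, y \in ys -> oq y = q.
Hypothesis q'_new : forall y, oq y != q'.

Definition new_cls (y : C) : nat := if y \in ys then q' else oq y.
Local Notation nq := new_cls.
Local Notation S := [set y | y \in ys]%classic.
Local Notation B := [set y | oq y = q]%classic.

Definition split_value (x : C) : value := fmap (chi S B) (c x).
Local Notation val := split_value.

Lemma sub_SB : (S `<=` B)%classic.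
Proof. by move=> y; apply: ys_q. Qed.

Lemma split_value_obs x : observations c (val x).
Proof. by exists x, S, B; split=> //; apply: sub_SB. Qed.

Definition unchanged_by_update (s : store) :=
  (pnum s, pblk s, pmem s, qnum s, qblk s, qmem s, work s, pred_edges s,
   mark s, touched s).

Definition edges_from_into (x : C) : seq edgeT :=
  [seq e <- edges_into (flat := flat) c ys | edge_src e == x].

Lemma mem_edges_from_into x e :
  (e \in edges_from_into x) =
  [&& e \in E, edge_src e == x & edge_tgt e \in ys].
Proof.
rewrite /edges_from_into mem_filter /edges_into mem_filter.
by case: (e \in E); rewrite ?andbF ?andbT.
Qed.

(** The old cell is overwritten with the weight of [B \ S] and goes on serving the edges from [x]
    into [B \ S]; those into [S] move to a fresh common cell. By [last_w_eq], no edge from another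
    state or into another block refers to the overwritten cell. *)
Lemma update_stateP (cls : C -> C -> nat) (s : store) x i v0 :
  cells_ok c w cls s -> cls x = oq ->
  perm_eq (to_sub s x : seq edgeT) (edges_from_into x) -> ~~ nilp (to_sub s x) ->
  (exists e, [/\ e \in E, edge_src e = x, edge_tgt e \in ys &
                 i = last_w s (edge_id e)]) ->
  observations c v0 ->
  wp (update_state M v0 (x, i)) (fun o s' k =>
    [/\ unchanged_by_update s' = unchanged_by_update s,
        to_sub s' = set_at (to_sub s) x [::],
        (forall e, e \in E -> edge_src e != x ->
           last_w s' (edge_id e) = last_w s (edge_id e))
          /\ cells_ok c w (fun z => if z == x then nq else cls z) s',
        o = (if `[< val x = v0 >] then None else Some (val x, x)) &
        k <= 12 * (T * size (to_sub s x))]) s.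
Proof.
case: s => pn pb pm qn qb qm wk pe ts lw cn cl mk td [/= Hlt Hcell Heq].
move=> clsx pes nes [e0 [e0E e0x e0y ->]] ov0.
set es := (ts x : seq edgeT) in pes nes *.
have lab : label_bag es = labels_into (flat (c x)) S := label_bag_into pes.
have clB : cl (lw (edge_id e0)) = Some (w B (c x)).
  by rewrite Hcell // e0x clsx (ys_q e0y).
have upd : update (label_bag es) (w B (c x)) =
    (w S (c x), val x, w (B `\` S)%classic (c x)).
  by have [_ /(_ S B sub_SB)] := wF (c x); rewrite lab.
rewrite /update_state.
apply: wp_bind; apply: wp_read; apply: wp_bind; apply: wp_write.
apply: wp_bind; apply: wp_read => /=; rewrite -/es clB.
apply: wp_bind; apply: wp_call; rewrite upd /=.
apply: wp_bind; apply: wp_write; apply: wp_bind.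
apply: wp_bind; apply: wp_read; apply: wp_bind; apply: wp_write.
apply: wp_bind; apply: wp_write; apply: wp_ret.
apply: wp_bind; apply: for_each_last_w.
apply: wp_bind; apply: wp_call; apply: wp_ret => /=.
have esE e : (e \in (es : seq edgeT)) = [&& e \in E, edge_src e == x & edge_tgt e \in ys].
  by rewrite (perm_mem pes) mem_edges_from_into.
have lw'E e : e \in E ->
    (if edge_id e \in [seq edge_id e | e <- es] then cn else lw (edge_id e)) =
    if (edge_src e == x) && (edge_tgt e \in ys) then cn
                      else lw (edge_id e).
  move=> eE; rewrite -[_ && _]/(true && _) -eE -esE.
  congr (if _ then _ else _); apply/(@mapP edgeT)/idP => [[e' e'es ee']|ees]; last by exists e.
  have e'E : e' \in E by move: e'es; rewrite esE => /andP[].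
  by rewrite (edge_id_inj eE e'E ee').
have qq' : q <> q' by move=> qq'; have := q'_new (edge_tgt e0); rewrite ys_q // qq' eqxx.
have lt0 := Hlt e0 e0E.
split=> //.
- split=> [e eE ex|]; first by rewrite lw'E // (negPf ex).
  split=> /=.
  + move=> e eE; rewrite lw'E //; case: ifP => // _.
    by apply: leq_trans (Hlt _ eE) _.
  + move=> e eE; rewrite lw'E //; case: ifP => [/andP[/eqP ex ey]|exy].
      rewrite ex eqxx /set_at eqxx; congr (Some (w _ _)).
      apply/funext => y; apply/propext; rewrite /= /nq ey.
      case: ifP => //; split=> // yq; have := q'_new y; by rewrite yq eqxx.
    have e_lt := Hlt _ eE.
    rewrite /set_at (ltn_eqF e_lt).
    case: (eqVneq (edge_src e) x) => [ex|ex]; last first.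
      case: eqP => [/(Heq _ _ eE e0E)[ee0 _]|_]; last exact: Hcell.
      by rewrite ee0 e0x eqxx in ex.
    have ey : edge_tgt e \in ys = false by move: exy; rewrite ex eqxx.
    rewrite /nq ey.
    case: eqP => [/(Heq _ _ eE e0E)[_]|ne].
      rewrite ex clsx (ys_q e0y) => eq_; congr (Some (w _ _)).
      apply/funext => y; apply/propext; rewrite /= eq_.
      split=> [[yq yn]|]; first by case: ifP.
      by case: ifP => [_ E|yn ->]; [case: qq'|split].
    rewrite Hcell // ex clsx; congr (Some (w _ _)).
    have eq_ : oq (edge_tgt e) <> q.
      by move=> eq_; apply: ne; apply/Heq => //; rewrite ex e0x clsx eq_ ys_q.
    apply/funext => y; apply/propext => /=; case: ifP => // yy; split=> yE.
      by case: eq_; rewrite -yE ys_q.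
    by have := q'_new (edge_tgt e); rewrite yE eqxx.
  + move=> e e' eE e'E; rewrite !lw'E //.
    have [lte lte'] := (Hlt _ eE, Hlt _ e'E).
    rewrite /nq; case: ifP => [/andP[/eqP ex ey]|exy].
      rewrite ex eqxx ey; case: ifP => [/andP[/eqP -> ->]//|e'xy].
      split=> [cnE|[ex' qE]]; first by rewrite -cnE ltnn in lte'.
      move: e'xy qE; rewrite ex' eqxx /= => -> qE.
      by have := q'_new (edge_tgt e'); rewrite -qE eqxx.
    case: ifP => [/andP[/eqP e'x e'y]|e'xy].
      split=> [cnE|[ex' +]]; first by rewrite cnE ltnn in lte.
      move: exy; rewrite ex' e'x eqxx e'y /= => -> qE.
      by have := q'_new (edge_tgt e); rewrite qE eqxx.
    have [ex|ex] := eqVneq (edge_src e) x; last exact: Heq.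
    rewrite Heq // ex clsx.
    split=> -[e'x qE]; split=> //; move: exy e'xy qE; rewrite ex -e'x eqxx /=.
      by move=> -> ->.
    by move=> -> ->.
- have cE := cmp3_eq M (val x) v0.
  case: asboolP => vv; first by rewrite (cE.2 vv).
  by case E3: cmp3 => //; case: vv; apply/cE.
- have t1 := time_updateP x sub_SB; rewrite -lab /label_bag bag_size_of size_map in t1.
  have t2 := time_cmp3P (split_value_obs x) ov0.
  (* A marked state has an edge into [S], which absorbs the single steps and the comparison:
     [12 = 7 + 3 + 1 + 1]. *)
  have sz_gt0 : 0 < size es by rewrite lt0n.
  have TS : size es <= T * size es by rewrite leq_pmull.
  have TT : T <= T * size es by rewrite leq_pmulr.
  move: t1; rewrite (maxn_idPr sz_gt0) => t1.
  move: t1 t2 TS TT T_gt0; rewrite /label_bag.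
  set tu := time_update _ _ _; set tc := time_cmp3 _ _ _; set Ts := T * _.
  by clearbody tu tc Ts; move: (size es) sz_gt0; clear; lia.
Qed.

(** The recorded cell is that of an edge into [S], and [cls] is still the old partition at this
    state; hence the cell contains the weight of [B]. *)
Definition marked (cls : C -> C -> nat) (s : store) (xi : C * nat) : Prop :=
  [/\ cls xi.1 = oq, perm_eq (to_sub s xi.1 : seq edgeT) (edges_from_into xi.1),
      ~~ nilp (to_sub s xi.1) &
      exists e, [/\ e \in E, edge_src e = xi.1, edge_tgt e \in ys &
                    xi.2 = last_w s (edge_id e)]].

Lemma collect_updateP (cls : C -> C -> nat) (s : store) (mk : seq (C * nat)) v0 :
  cells_ok c w cls s -> uniq [seq xi.1 | xi <- mk] ->
  (forall xi, xi \in mk -> marked cls s xi) -> observations c v0 ->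
  wp (collect mk (update_state M v0)) (fun vs s' k =>
    [/\ unchanged_by_update s' = unchanged_by_update s,
        to_sub s' = (fun z => if z \in [seq xi.1 | xi <- mk] then [::]
                              else to_sub s z),
        (forall e, e \in E -> edge_src e \notin [seq xi.1 | xi <- mk] ->
           last_w s' (edge_id e) = last_w s (edge_id e))
          /\ cells_ok c w (fun z => if z \in [seq xi.1 | xi <- mk] then nq
                                    else cls z) s',
        vs = [seq (val xi.1, xi.1) | xi <- mk & ~~ `[< val xi.1 = v0 >]] &
        k <= 13 * (T * \sum_(xi <- mk) size (to_sub s xi.1))]) s.
Proof.
move=> cs umk mkP ov0.
apply: (wp_collect (Inv := fun (done : seq (C * nat)) vs s' k =>
    [/\ unchanged_by_update s' = unchanged_by_update s,
        to_sub s' = (fun z => if z \in [seq xi.1 | xi <- done] then [::]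
                              else to_sub s z),
        (forall e, e \in E -> edge_src e \notin [seq xi.1 | xi <- done] ->
           last_w s' (edge_id e) = last_w s (edge_id e))
          /\ cells_ok c w (fun z => if z \in [seq xi.1 | xi <- done] then nq
                                    else cls z) s',
        vs = [seq (val xi.1, xi.1) | xi <- done & ~~ `[< val xi.1 = v0 >]] &
        k <= 13 * (T * \sum_(xi <- done) size (to_sub s xi.1))])).
  by split.
move=> done [x i] todo vs s' k Emk [Eu Ets [Elw cs'] Evs lek].
have xmk : (x, i) \in mk by rewrite Emk mem_cat mem_head orbT.
have [clsx pes nes [e [eE ex ey iE]]] := mkP _ xmk.
have xd : x \notin [seq xi.1 | xi <- done].
  move: umk; rewrite Emk map_cat cat_uniq => /and3P[_ /hasPn/(_ x)].
  by rewrite /= mem_head => /(_ isT).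
have tsx : to_sub s' x = to_sub s x by rewrite Ets (negPf xd).
have H : wp (update_state M v0 (x, i)) (fun o s'' k =>
    [/\ unchanged_by_update s'' = unchanged_by_update s',
        to_sub s'' = set_at (to_sub s') x [::],
        (forall e, e \in E -> edge_src e != x ->
           last_w s'' (edge_id e) = last_w s' (edge_id e))
          /\ cells_ok c w (fun z => if z == x then nq else
               if z \in [seq xi.1 | xi <- done] then nq else cls z) s'',
        o = (if `[< val x = v0 >] then None else Some (val x, x)) &
        k <= 12 * (T * size (to_sub s' x))]) s'.
  apply: update_stateP => //; rewrite ?tsx ?(negPf xd) //.
  by exists e; split=> //; rewrite Elw // ex.
apply: wp_conseq H => o s'' k' [Eu' Ets' [Elw' cs''] Eo lek'].
have memE z : (z \in [seq xi.1 | xi <- rcons done (x, i)]) =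
    (z == x) || (z \in [seq xi.1 | xi <- done]).
  by rewrite map_rcons mem_rcons inE.
split.
- by rewrite Eu'.
- rewrite Ets' Ets; apply/funext => z; rewrite memE /set_at.
  by case: (z == x).
- split=> [e' e'E|].
    by rewrite memE negb_or => /andP[e'x e'd]; rewrite Elw' // Elw.
  suff -> : (fun z => if z \in [seq xi.1 | xi <- rcons done (x, i)] then nq
             else cls z) = (fun z => if z == x then nq else
               if z \in [seq xi.1 | xi <- done] then nq else cls z) by [].
  by apply/funext => z; rewrite memE; case: (z == x).
- rewrite Eo filter_rcons Evs /=; case: asboolP => _ //=.
  by rewrite map_rcons.
- rewrite -cats1 big_cat big_seq1 /= mulnDr.
  rewrite tsx in lek'.
  have sz_gt0 : 0 < T * size (to_sub s x) by rewrite muln_gt0 T_gt0 lt0n.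
  move: lek lek' sz_gt0.
  by move: (T * _) (T * _); clear; lia.
Qed.

(** Part of the potential during a refinement: every visited edge prepays a share of the regrouping
    of its source, and is released when [update_state] empties the list. *)
Definition total_to_sub (s : store) : nat := \sum_x size (to_sub s x).

Local Notation energy s := (total_to_sub s + potential (fun=> 1) (pblk s)).

Lemma eq_partitions_fields D (s s' : store) :
  (pnum s', pblk s', pmem s', qnum s', qblk s', qmem s', work s') =
  (pnum s, pblk s, pmem s, qnum s, qblk s, qmem s, work s) ->
  partitions D s -> partitions D s'.
Proof.
case=> E1 E2 E3 E4 E5 E6 E7 [H1 H2 H3 H4 H5 H6 H7 H8 H9].
by split; rewrite ?E1 ?E2 ?E3 ?E4 ?E5 ?E6 ?E7.
Qed.

Lemma observed_time u v : `[< observations c u >] -> `[< observations c v >] ->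
  time_cmp3 M u v <= T.
Proof. by move=> /asboolP ou /asboolP; apply: time_cmp3P. Qed.

Lemma regroupP (cls : C -> C -> nat) (s : store) b v0 :
  partitions predT s -> b < pnum s -> cells_ok c w cls s ->
  ~~ nilp (mark s b) -> uniq [seq xi.1 | xi <- mark s b] ->
  (forall xi, xi \in mark s b -> pblk s xi.1 = b /\ marked cls s xi) ->
  (forall x, pblk s x = b -> x \notin [seq xi.1 | xi <- mark s b] -> val x = v0) ->
  observations c v0 ->
  wp (regroup M (b, v0)) (fun _ s' k =>
    [/\ [/\ partitions predT s', (forall x, qcls s' x = qcls s x),
            pnum s <= pnum s' &
            (qnum s', pred_edges s', touched s') =
            (qnum s, pred_edges s, touched s)],
        (forall x, pblk s x <> b -> pblk s' x = pblk s x),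
        (forall x y, pblk s' x = pblk s' y <->
           pblk s x = pblk s y /\ (pblk s x = b -> val x = val y)),
        [/\ mark s' = set_at (mark s) b [::],
            to_sub s' = (fun z => if z \in [seq xi.1 | xi <- mark s b] then [::]
                                  else to_sub s z),
            (forall e, e \in E -> edge_src e \notin [seq xi.1 | xi <- mark s b] ->
               last_w s' (edge_id e) = last_w s (edge_id e)) &
            cells_ok c w (fun z => if z \in [seq xi.1 | xi <- mark s b] then nq
                                   else cls z) s'] &
        1 + k + 72 * (T * energy s') <= 72 * (T * energy s)]) s.
Proof.
move=> Ps bs cs nmk umk mkP unm ov0.
rewrite /regroup; set mk := mark s b in nmk umk mkP unm *.
apply: wp_bind; apply: wp_read; apply: wp_bind; apply: wp_write.
rewrite -/mk; set s1 := set_mark _ _.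
have [Eu1 Er1] : (pnum s1, pblk s1, pmem s1, qnum s1, qblk s1, qmem s1, work s1) =
    (pnum s, pblk s, pmem s, qnum s, qblk s, qmem s, work s) /\
    (pred_edges s1, to_sub s1, last_w s1, cnum s1, cell s1, mark s1, touched s1) =
    (pred_edges s, to_sub s, last_w s, cnum s, cell s,
     set_at (mark s) b [::], touched s).
  by rewrite /s1; case: (s).
have P1 := eq_partitions_fields Eu1 Ps.
case: Eu1 => Epn Epb Epm Eqn Eqb Eqm Ewk.
case: Er1 => Epe Ets Elw Ecn Ecl Emk Etd.
have cs1 : cells_ok c w cls s1 by apply: eq_cells_ok cs.
have mk1 xi : xi \in mk -> marked cls s1 xi.
  by move=> /mkP[_ [H1 H2 H3 H4]]; split; rewrite ?Ets ?Elw.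
apply: wp_bind; apply: wp_conseq (collect_updateP cs1 umk mk1 ov0).
move=> vs0 s2 k1; move: (vs0 : seq (value * C)) => vs {vs0} [Eu2 Ets2 [Elw2 cs2] Evs lek1].
have P2 : partitions predT s2 by apply: eq_partitions_fields P1; case: Eu2 => -> -> -> -> -> -> ->.
case: Eu2; rewrite Epn Epb Epm Eqn Eqb Eqm Ewk Epe Emk Etd.
move=> Epn2 Epb2 Epm2 Eqn2 Eqb2 Eqm2 Ewk2 Epe2 Emk2 Etd2.
have vsP v x : (v, x) \in vs <->
    [/\ pblk s x = b, v = val x & val x <> v0].
  rewrite Evs; split=> [/mapP[[x' i]]|[xb -> xv]].
    rewrite mem_filter => /andP[/asboolPn xv /mkP[xb _]] [-> ->].
    by split.
  have : x \in [seq xi.1 | xi <- mk].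
    by apply/negPn/negP => /(unm _ xb).
  case/mapP=> xi ximk xE; apply/mapP; exists xi; last by rewrite xE.
  by rewrite mem_filter ximk andbT -xE; apply/asboolPn.
have uvs : uniq [seq vx.2 | vx <- vs].
  rewrite Evs -map_comp (eq_map (g := fst)) //.
  by apply: subseq_uniq umk; apply/map_subseq/filter_subseq.
have vs_le : size vs <= size mk by rewrite Evs size_map size_filter count_size.
have Ovs : all (fun v : value => `[< observations c v >])
               [seq vx.1 | vx <- vs].
  by rewrite Evs -map_comp all_map; apply/allP => xi _ /=; apply/asboolP/split_value_obs.
apply: wp_bind; apply: wp_conseq (group_byP s2 T_gt0 observed_time Ovs).
move=> r0 _ k2 [-> sr pr lek2].
move: (r0 : seq group) sr pr lek2 => r {r0} sr pr lek2.
apply: wp_bind; apply: wp_read; rewrite Epm2.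
set l : seq group := if _ then _ else _.
have upr : uniq (pairs r) by rewrite (perm_uniq pr); apply: map_uniq uvs.
have rP h : h \in r -> [/\ uniq h.2, ~~ nilp h.2 &
    forall y, (y \in h.2) = (pblk s y == b) && (val y == h.1)].
  move=> hr; have nh : ~~ nilp h.2 by case/andP: sr => _ /allP/(_ _ hr).
  split=> //; first exact: uniq_group upr hr.
  have [x xh] : exists x, x \in h.2.
    by case: (h.2) nh => // x xs _; exists x; rewrite mem_head.
  have hx : (h.1, x) \in vs by rewrite -(perm_mem pr) -(mem_group _ sr hr).
  have [_ hE nv0] := (vsP _ _).1 hx.
  move=> y; rewrite (mem_group _ sr hr) (perm_mem pr).
  apply/idP/andP => [/vsP[-> -> _]|[/eqP yb /eqP yv]]; first by rewrite !eqxx.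
  by apply/vsP; split=> //; rewrite yv hE.
have statesE : states r =i [seq vx.2 | vx <- vs].
  move=> x; apply/mem_states/mapP => [[h hr xh]|[[v x'] vxvs /= ->]].
    by exists (h.1, x) => //; rewrite -(perm_mem pr) -(mem_group _ sr hr).
  move: vxvs; rewrite -(perm_mem pr) => vx.
  have /mapP[h hr vE] := mem_keys vx.
  by exists h => //; rewrite (mem_group _ sr hr) -vE.
have size_st : size (states r) = size vs.
  rewrite -(perm_size pr) /states /pairs !size_flatten /shape -!map_comp; congr sumn.
  by apply: eq_map => h /=; rewrite size_map.
have vs_pmem : {subset [seq vx.2 | vx <- vs] <= pmem s b}.
  by move=> _ /mapP[[v x] /vsP[xb _ _] ->]; rewrite (mem_pmem Ps) //= xb.
(* [z] is a state of [b] that is not moved. If [vs] exhausts [b], it is taken from the first group,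
   which stays; otherwise some state of [b] has the value [v0]. In both cases all unmoved states of
   [b] have the same value. *)
have [z [zb zl lN lr]] : exists z, [/\ pblk s z = b, z \notin states l,
    (forall x y, pblk s x = b -> pblk s y = b -> x \notin states l ->
       y \notin states l -> val x = val y) &
    [/\ {subset l <= r}, uniq (keys l) & size (states l) <= size (states r)]].
  have ukr := uniq_keys sr.
  rewrite /l; case: eqP => [szE|szN].
    have [_ memE] := uniq_min_size uvs vs_pmem (eq_leq (esym (etrans (size_map _ _) szE))).
    have [x0 x0b] : exists x, x \in pmem s b.
      by case: (pmem s b) (pmem_nil Ps bs) => // x xs _; exists x; rewrite mem_head.
    move: x0b; rewrite -memE -statesE => x0r.
    move: (r) rP statesE x0r ukr => [//|h0 r'] rP' statesE' _ /= /andP[h0r' ur'].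
    have [uh0 nh0 h0P] := rP' h0 (mem_head _ _).
    have [z zh0] : exists z, z \in h0.2.
      by case: (h0.2) nh0 => // z zs _; exists z; rewrite mem_head.
    exists z; split.
    + by move: zh0; rewrite h0P => /andP[/eqP].
    + apply: contra h0r' => /mem_states[h hr' zh].
      have [_ _ hP] := rP' h (mem_behead (s := h0 :: r') hr').
      move: zh zh0; rewrite hP h0P => /andP[_ /eqP vh] /andP[_ /eqP vh0].
      rewrite -vh0 vh.
      exact: (map_f (fun h : group => h.1)).
    + move=> x y xb yb xr yr.
      have in_h0 x' : pblk s x' = b -> x' \notin states r' -> val x' = h0.1.
        move=> x'b x'r; have : x' \in states (h0 :: r').
          by rewrite statesE' memE (mem_pmem Ps) //= x'b.
        rewrite /states /= mem_cat (negPf x'r) orbF h0P.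
        by case/andP=> _ /eqP.
      by rewrite !in_h0.
    + split=> //; first by move=> h hr'; rewrite inE hr' orbT.
      by rewrite /states /= size_cat leq_addl.
  have [z zb zvs] : exists2 z, z \in pmem s b & z \notin [seq vx.2 | vx <- vs].
    apply/hasP; rewrite -[has _ _]negbK -all_predC; apply/negP => /allP al.
    case: szN; rewrite -(size_map snd); apply/eqP; rewrite eqn_leq.
    rewrite uniq_leq_size //= uniq_leq_size ?(pmem_uniq Ps) // => x xb.
    by have /= := al x xb; rewrite negbK.
  exists z; split=> //.
  + by move: zb; rewrite (mem_pmem Ps) //= => /eqP.
  + by rewrite statesE.
  + have eq0 x : pblk s x = b -> x \notin states r -> val x = v0.
      move=> xb; rewrite statesE => xr; apply: contrapT => xv.
      by case/negP: xr; apply/mapP; exists (val x, x) => //; apply/vsP.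
    by move=> x y xb yb xr yr; rewrite !eq0.
  + by split.
have [lr' ukl szl] := lr.
have lP h : h \in l -> [/\ uniq h.2, ~~ nilp h.2 &
    forall y, (y \in h.2) = (pblk s2 y == b) && (val y == h.1)].
  by move=> /lr'/rP; rewrite Epb2.
have st_b x : x \in states l -> pblk s x = b.
  by case/mem_states=> h /lr'/rP[_ _ ->] /andP[/eqP].
have bs2 : b < pnum s2 by rewrite Epn2.
have zb2 : pblk s2 z = b by rewrite Epb2.
apply: wp_conseq (split_groupsP P2 bs2 ukl lP zb2 zl).
move=> [] s' k3 [P' Er' Eq' [Epb' Erel] [Epn' lek3]].
case: Er' => Eqn' Epe' Ets' Elw' Ecn' Ecl' Emk' Etd'.
have rel x y : pblk s' x = pblk s' y <->
    pblk s x = pblk s y /\ (pblk s x = b -> val x = val y).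
  rewrite Erel Epb2; split=> -[pxy vxy]; split=> //.
    move=> xb; have yb : pblk s y = b by rewrite -pxy.
    case xl: (x \in states l); first by apply: vxy; rewrite xl.
    case yl: (y \in states l); first by apply: vxy; rewrite yl orbT.
    by apply: lN; rewrite ?xl ?yl.
  by case/orP=> [/st_b|/st_b yb]; [apply: vxy|apply: vxy; rewrite pxy].
split=> //.
- split=> //.
  + by move=> x; rewrite Eq' /qcls Eqb2 Epb2.
  + by rewrite -Epn2.
  + by rewrite Eqn' Epe' Etd' Eqn2 Epe2 Etd2.
- move=> x xb; rewrite Epb' ?Epb2 //; apply/negP => /st_b; exact: xb.
- split.
  + by rewrite Emk' Emk2.
  + by rewrite Ets' Ets2 Ets.
  + by move=> e eE ex; rewrite Elw' Elw2 // Elw.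
  + exact: eq_cells_ok cs2.
- have ent := grouping_entropy (f := pblk s) (f' := pblk s') (b := b) (val := val)
    (fun x y => (rel x y).1) sr pr uvs
    (fun v x h => let: And3 h1 h2 _ := (vsP v x).1 h in conj h2 h1).
  have {}ent := ent (fun v x y h yb yv => (vsP v y).2
    (And3 yb (esym yv) (fun e => let: And3 _ h2 h3 := (vsP v x).1 h in
       h3 (etrans (esym h2) (etrans (esym yv) e))))).
  have totE : total_to_sub s = total_to_sub s' + \sum_(xi <- mk) size (to_sub s1 xi.1).
    rewrite /total_to_sub Ets' Ets2 Ets (bigID (fun x => x \in [seq xi.1 | xi <- mk])) /=.
    rewrite [X in _ = X + _](bigID (fun x => x \in [seq xi.1 | xi <- mk])) /=.
    rewrite [X in _ = X + _ + _]big1 => [|x ->//].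
    rewrite add0n addnC; congr addn.
      by apply: eq_bigr => x /negPf ->.
    by rewrite -big_uniq //= big_map.
  have mk_le : size mk <= \sum_(xi <- mk) size (to_sub s1 xi.1).
    rewrite -sum1_size big_seq [X in _ <= X]big_seq; apply: leq_sum => xi /mk1[_ _ + _].
    by rewrite lt0n.
  have mk_gt0 : 0 < size mk by rewrite lt0n.
  rewrite totE; move: lek1 lek2 lek3 ent mk_le mk_gt0 szl vs_le T_gt0; rewrite size_st.
  move: (\sum_(xi <- mk) _) (\sum_(h <- r) _) (total_to_sub _) (potential _ _) (potential _ _).
  move: (size vs) (size mk) (size (states l)); clear.
  move=> n m n' u ent t p p' lek1 lek2 lek3 lee le1 le2 le3 le4 T_gt0.
  (* [72 = 4 + 13 + 20 + 20 + 15], in multiples of [T * u] with [u] the number of edges released: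
     single steps, updates, the two summands of the grouping bound besides the entropy, and the
     splitting. The entropy is paid for by the potential of P. *)
  have : T * (p' + ent) <= T * p by rewrite leq_mul2l lee orbT.
  have : T * n <= T * u by rewrite leq_mul2l orbC; lia.
  have : T <= T * u by rewrite leq_pmulr //; lia.
  have : u <= T * u by rewrite leq_pmull.
  move: lek1 lek2 lek3; rewrite -!mulnA !mulnDr ?muln1.
  move: (T * u) (T * ent) (T * p) (T * p') (T * n) (T * t); clear -le1 le2 le3 le4 T_gt0; lia.
Qed.

End Regroup.

(** * Refining P by one block *)

Lemma sum_affine (K : Type) (l : seq K) (f : K -> nat) a t :
  \sum_(y <- l) (2 + a * (t * f y)) = 2 * size l + a * (t * \sum_(y <- l) f y).
Proof.
elim: l => [|y l IH]; first by rewrite !big_nil !muln0.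
by rewrite !big_cons IH /= !mulnDr mulnS; lia.
Qed.

Lemma mem_cat_head (K : eqType) (x : K) (l1 l2 : seq K) : x \in l1 ++ x :: l2.
Proof. by rewrite mem_cat mem_head orbT. Qed.

Section RefineBy.
Context {F : set_functor} {A : Type} {flat : encoding F A}.
Context {I : refinement_interface flat} (M : implementation I) {C : finType}.
Variable c : C -> F C.
Variable w : forall X : Type, set X -> F X -> weight I.
Hypothesis wF : weight_family flat (init I) (@update _ _ _ I) w.
Variable T : nat.
Hypothesis T_gt0 : 0 < T.
Hypothesis time_updateP : forall x (S B : set C), (S `<=` B)%classic ->
  time_update M (labels_into (flat (c x)) S) (w B (c x))
    <= T * maxn 1 (bag_size (labels_into (flat (c x)) S)).
Hypothesis time_cmp3P : forall u v, observations c u -> observations c v ->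
  time_cmp3 M u v <= T.

Local Notation value := {classic (F 'I_3)}.
Local Notation store := (memory F A (weight I) C).
Local Notation edgeT := {classic (edge A C)}.
Local Notation E := (edges (flat := flat) c : seq edgeT).

Variables (ys : seq C) (oq : C -> nat) (q q' : nat).
Hypothesis ys_uniq : uniq ys.
Hypothesis ys_q : forall y, y \in ys -> oq y = q.
Hypothesis q'_new : forall y, oq y != q'.

Local Notation nq := (new_cls ys oq q').
Local Notation S := [set y | y \in ys]%classic.
Local Notation B := [set y | oq y = q]%classic.
Local Notation val := (split_value c ys oq q).

Variable s0 : store.
Hypothesis P0 : partitions predT s0.
Hypothesis pred0 : pred_edges s0 = edges_to (flat := flat) c.
Hypothesis to_sub0 : to_sub s0 = (fun=> [::]).
Hypothesis mark0 : mark s0 = (fun=> [::]).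
Hypothesis touched0 : touched s0 = [::].
Hypothesis cells0 : cells_ok c w (fun=> oq) s0.
Hypothesis stable0 : forall x y, pblk s0 x = pblk s0 y ->
  fmap oq (c x) = fmap oq (c y).

Definition unmarked_value (x : C) : value := fmap (chi set0 B) (c x).

Lemma unmarked_value_obs x : observations c (unmarked_value x).
Proof. by exists x, set0, B; split=> //; apply: sub0set. Qed.

(** As chi_0^B factors through [oq], stability applies. Hence the call of [update] made at the first
    visited state of a block yields the value of all unmarked states of that block. *)
Lemma unmarked_value_block x y :
  pblk s0 x = pblk s0 y -> unmarked_value x = unmarked_value y.
Proof.
move=> /stable0; apply: (fmap_factor zero3) => z z' zz'.
by rewrite /chi /= zz'.
Qed.

(** * Visiting the edges into S *)

Definition unchanged_by_visit (s : store) :=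
  (pnum s, pblk s, pmem s, qnum s, qblk s, qmem s, work s, pred_edges s,
   last_w s, cnum s, cell s).

Definition sources (vis : seq edgeT) : seq C := [seq edge_src e | e <- vis].

Record visited (vis : seq edgeT) (s : store) : Prop := Visited {
  visited_frame : unchanged_by_visit s = unchanged_by_visit s0;
  visited_to_sub : forall x,
    to_sub s x = [seq e <- rev vis | edge_src (e : edgeT) == x];
  visited_mark_uniq : forall b, uniq [seq xi.1 | xi <- mark s b];
  visited_mark : forall b x, (x \in [seq xi.1 | xi <- mark s b]) =
    (pblk s0 x == b) && (x \in sources vis);
  visited_mark_cell : forall b xi, xi \in mark s b ->
    exists2 e, e \in vis & edge_src e = xi.1 /\ xi.2 = last_w s0 (edge_id e);
  visited_touched_uniq : uniq [seq bv.1 | bv <- touched s];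
  visited_touched : forall b,
    (b \in [seq bv.1 | bv <- touched s]) = ~~ nilp (mark s b);
  visited_touched_value : forall bv, bv \in (touched s : seq (nat * value)) ->
    exists2 x, pblk s0 x = bv.1 & bv.2 = unmarked_value x
}.

Lemma visited_nil : visited [::] s0.
Proof.
split; rewrite ?to_sub0 ?mark0 ?touched0 //=.
by move=> b x; rewrite andbF.
Qed.

(** Emptiness of [mark b] and of [to_sub x] serves as the test whether [b] is touched and [x] is
    marked, so both must be empty again before the next refinement. The worst case is ten single
    steps and one call of [update] with the empty bag, hence [11 * T]. *)
Lemma visit_edgeP vis s (e : edgeT) :
  visited vis s -> e \in E -> edge_tgt e \in ys ->
  wp (visit_edge M e) (fun _ s' k => visited (rcons vis e) s' /\ 1 + k <= 11 * T) s.
Proof.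
case: s => pn pb pm qn qb qm wk pe ts lw cn cl mk td [/=].
case=> -> -> -> -> -> -> -> -> -> -> -> Hts Hmu Hm Hmc Htu Ht Htv eE ey.
set x := edge_src e; set b := pblk s0 x.
have clE : cell s0 (last_w s0 (edge_id e)) = Some (w B (c x)).
  by rewrite (cell_w cells0 eE) (ys_q ey).
have upd := update_nil wF (c x) B.
have tupd : time_update M (label_bag ([::] : seq (edge A C))) (w B (c x)) <= T.
  have := time_updateP x (@sub0set _ B); rewrite labels_into0 bag_size_of /=.
  by rewrite maxn0 muln1.
have src_rcons z : (z \in sources (rcons vis e)) = (z == x) || (z \in sources vis).
  by rewrite /sources map_rcons mem_rcons inE.
have nil_ts : nilp (ts x) = (x \notin sources vis).
  rewrite Hts /nilp size_filter -leqn0 leqNgt -has_count; congr negb.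
  by rewrite has_rev; apply/(@hasP edgeT)/(@mapP edgeT) => [[e' e'v /eqP <-]|[e' e'v ->]]; exists e'.
have fin mk' td' : 
    (forall b', uniq [seq xi.1 | xi <- mk' b']) ->
    (forall b' z, (z \in [seq xi.1 | xi <- mk' b']) =
      (pblk s0 z == b') && ((z == x) || (z \in sources vis))) ->
    (forall b' xi, xi \in mk' b' ->
       xi = (x, last_w s0 (edge_id e)) \/ xi \in mk b') ->
    uniq [seq bv.1 | bv <- td'] ->
    (forall b', (b' \in [seq bv.1 | bv <- td']) = ~~ nilp (mk' b')) ->
    (forall bv, bv \in (td' : seq (nat * value)) ->
       bv = (b, unmarked_value x) \/ bv \in (td : seq (nat * value))) ->
    visited (rcons vis e)
      (Memory (pnum s0) (pblk s0) (pmem s0) (qnum s0) (qblk s0) (qmem s0)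
         (work s0) (pred_edges s0) (set_at ts x (e :: ts x)) (last_w s0)
         (cnum s0) (cell s0) mk' td').
  move=> H1 H2 H3 H4 H5 H6; split=> //=.
  - move=> z; rewrite rev_rcons /= /set_at -/x; case: eqP => [->|zx].
      by rewrite eqxx Hts.
    by case: eqP => [xz|_]; [case: zx|rewrite Hts].
  - by move=> b' z; rewrite src_rcons.
  - move=> b' xi /H3[->|/Hmc[e' e'v e'P]].
      by exists e => //; rewrite mem_rcons mem_head.
    by exists e' => //; rewrite mem_rcons inE e'v orbT.
  - by move=> bv /H6[->|/Htv//]; exists x.
rewrite /visit_edge -/x.
apply: wp_bind; apply: wp_read; apply: wp_bind; apply: wp_read.
apply: wp_bind; apply: wp_read => /=; rewrite -/b.
case nmk : (nilp (mk b)).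
  have mkb : mk b = [::] by apply/nilP.
  have xv : x \notin sources vis.
    by have := Hm b x; rewrite mkb eqxx /= => <-.
  apply: wp_bind; apply: wp_bind; apply: wp_read => /=; rewrite clE.
  apply: wp_bind; apply: wp_call; apply: wp_bind; apply: wp_read; apply: wp_write => /=.
  apply: wp_bind; apply: wp_read; apply: wp_bind => /=; rewrite nil_ts xv.
  apply: wp_write; apply: wp_write => /=; split; last first.
    by move: tupd T_gt0; set t := time_update _ _ _; clearbody t; clear; lia.
  rewrite /label_bag /= upd /= mkb; apply: fin.
  - by move=> b'; rewrite /set_at; case: eqP.
  - move=> b' z; rewrite /set_at; case: (eqVneq b' b) => [->|b'b] /=.
      rewrite inE; case: (eqVneq z x) => [->|zx] /=; first by rewrite eqxx.
      by have := Hm b z; rewrite mkb /=.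
    rewrite Hm; case: (eqVneq z x) => [->|//]; rewrite -/b eq_sym (negPf b'b) //.
  - move=> b' xi; rewrite /set_at; case: eqP => [_|_]; last by right.
    by rewrite inE => /eqP ->; left.
  - by rewrite /= Htu andbT Ht mkb.
  - by move=> b'; rewrite /= inE Ht /set_at; case: eqP.
  - by move=> bv; rewrite inE => /orP[/eqP ->|]; [left|right].
apply: wp_bind; apply: wp_ret; apply: wp_bind; apply: wp_read; apply: wp_bind => /=.
rewrite nil_ts; apply: wp_when => xv; last first.
  apply: wp_write => /=; split; last by move: T_gt0; clear; lia.
  apply: fin => //; try by move=> *; right.
  - move=> b' z; rewrite Hm; case: (eqVneq z x) => [->|//].
    by rewrite (negPn xv).
apply: wp_write; apply: wp_write => /=; split; last by move: T_gt0; clear; lia.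
have xmk : x \notin [seq xi.1 | xi <- mk b] by rewrite Hm negb_and xv orbT.
apply: fin => //.
- by move=> b'; rewrite /set_at; case: eqP => //= _; rewrite xmk Hmu.
- move=> b' z; rewrite /set_at; case: (eqVneq b' b) => [->|b'b] /=.
    by rewrite inE Hm; case: (eqVneq z x) => [->|zx] /=; rewrite ?eqxx.
  by rewrite Hm; case: (eqVneq z x) => [->|//]; rewrite -/b eq_sym (negPf b'b).
- move=> b' xi; rewrite /set_at; case: eqP => [->|_]; last by right.
  by rewrite inE => /orP[/eqP ->|]; [left|right].
- by move=> b'; rewrite Ht /set_at; case: eqP => [->|//]; rewrite nmk.
- by move=> bv; right.
Qed.

Lemma visitP :
  wp (for_each ys (fun y =>
        let* es := read (fun s => pred_edges s y) in for_each es (visit_edge M)))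
     (fun _ s' k => visited (flatten [seq edges_to (flat := flat) c y | y <- ys]) s' /\
        k <= \sum_(y <- ys) (2 + 11 * (T * size (edges_to (flat := flat) c y)))) s0.
Proof.
apply: (wp_for_each (Inv := fun done s' k =>
  visited (flatten [seq edges_to (flat := flat) c y | y <- done]) s' /\
  k <= \sum_(y <- done) (2 + 11 * (T * size (edges_to (flat := flat) c y))))).
  by split=> //; apply: visited_nil.
move=> done y todo s k El [vs lek].
have yys : y \in ys by rewrite El mem_cat mem_head orbT.
apply: wp_bind; apply: wp_read.
have -> : pred_edges s y = edges_to (flat := flat) c y.
  by case: (visited_frame vs) => _ _ _ _ _ _ _ -> _ _ _; rewrite pred0.
set vis := flatten _ in vs.
have H : wp (for_each (edges_to (flat := flat) c y) (visit_edge M)) (fun _ s' k =>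
    visited (vis ++ edges_to (flat := flat) c y) s' /\
    k <= 11 * (T * size (edges_to (flat := flat) c y))) s.
  apply: (wp_for_each (Inv := fun (done : seq edgeT) s' k =>
    visited (vis ++ done) s' /\ k <= 11 * (T * size done))).
    by rewrite cats0.
  move=> dn e td s1 k1 Ey [vs1 lek1].
  have : e \in edges_to (flat := flat) c y by rewrite Ey mem_cat mem_head orbT.
  rewrite /edges_to mem_filter mem_rev => /andP[/eqP ey eE].
  have ey' : edge_tgt e \in ys by rewrite ey.
  apply: wp_conseq (visit_edgeP vs1 eE ey') => _ s2 k2 [vs2 lek2].
  rewrite -rcons_cat; split=> //; rewrite size_rcons mulnS; lia.
apply: wp_conseq H => _ s' k' [vs' lek']; split.
  by rewrite -cats1 map_cat flatten_cat /= cats0.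
by rewrite -cats1 big_cat big_seq1 /=; lia.
Qed.

Lemma unmarked_split_value vis x :
  perm_eq vis (edges_into (flat := flat) c ys) -> x \notin sources vis ->
  val x = unmarked_value x /\ w (B `\` S)%classic (c x) = w B (c x).
Proof.
move=> pv xv; apply: (no_labels wF); first by move=> y; apply: ys_q.
apply/esym/(@label_bag_into F A flat C c ys x [::]).
suff E0 : edges_from_into (flat := flat) c ys x = [::] by rewrite -[filter _ _]/(edges_from_into c ys x) E0.
apply/eqP; rewrite -[_ == _]negbK -has_filter; apply/(@hasPn edgeT) => e.
rewrite -(perm_mem pv) => ev; apply: contra xv => /eqP <-.
exact: (map_f (fun e : edgeT => edge_src e)).
Qed.

(** * Regrouping the touched blocks *)

Section Regroup.
Variables (vis : seq edgeT) (s1 : store).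
Hypothesis visP : perm_eq vis (edges_into (flat := flat) c ys).
Hypothesis vis1 : visited vis s1.

Local Notation energy s := (total_to_sub s + potential (fun=> 1) (pblk s)).

Record regrouped (done : seq nat) (s : store) : Prop := Regrouped {
  regrouped_partitions : partitions predT s;
  regrouped_qcls : forall x, qcls s x = qcls s0 x;
  regrouped_pnum : pnum s0 <= pnum s;
  regrouped_frame : (qnum s, pred_edges s, touched s) =
                    (qnum s0, pred_edges s0, [::]);
  regrouped_pblk : forall x, pblk s0 x \notin done -> pblk s x = pblk s0 x;
  regrouped_rel : forall x y, pblk s x = pblk s y <->
    pblk s0 x = pblk s0 y /\ (pblk s0 x \in done -> val x = val y);
  regrouped_mark : mark s = (fun b => if b \in done then [::] else mark s1 b);
  regrouped_to_sub : to_sub s = (fun z =>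
    if (z \in sources vis) && (pblk s0 z \in done) then [::] else to_sub s1 z);
  regrouped_last_w : forall e, e \in E -> pblk s0 (edge_src e) \notin done ->
    last_w s (edge_id e) = last_w s0 (edge_id e);
  regrouped_cells : cells_ok c w (fun z =>
    if (z \in sources vis) && (pblk s0 z \in done) then nq else oq) s
}.

Lemma regrouped_step done s b v0 :
  regrouped done s -> b \notin done -> (b, v0) \in (touched s1 : seq (nat * value)) ->
  wp (regroup M (b, v0)) (fun _ s' k => regrouped (rcons done b) s' /\
    1 + k + 72 * (T * energy s') <= 72 * (T * energy s)) s.
Proof.
case=> Ps Eq Epn Efr Epb Erel Emk Ets Elw cs bd bt.
have [x0 x0b v0E] := visited_touched_value vis1 bt; rewrite /= in x0b v0E.
have mkb : mark s b = mark s1 b by rewrite Emk (negPf bd).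
have pblk_b x : pblk s x = b <-> pblk s0 x = b.
  have xb0 : pblk s x0 = b by rewrite Epb x0b.
  split=> [xb|xb]; last by rewrite Epb xb.
  by have /Erel[->] : pblk s x = pblk s x0 by rewrite xb xb0.
have mem_mk x : (x \in [seq xi.1 | xi <- mark s b]) =
    (pblk s0 x == b) && (x \in sources vis) by rewrite mkb (visited_mark vis1).
have bs : b < pnum s by rewrite -x0b (leq_trans _ Epn) // (pblk_lt P0).
have nmk : ~~ nilp (mark s b).
  rewrite mkb -(visited_touched vis1).
  exact: (map_f (fun bv : nat * value => bv.1) bt).
have umk : uniq [seq xi.1 | xi <- mark s b] by rewrite mkb (visited_mark_uniq vis1).
pose cls z := if (z \in sources vis) && (pblk s0 z \in done) then nq else oq.
have mkP xi : xi \in mark s b ->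
    pblk s xi.1 = b /\ marked c ys oq cls s xi.
  move=> xib; have : xi.1 \in [seq xi.1 | xi <- mark s b] by apply: map_f.
  rewrite mem_mk => /andP[/eqP xb xv].
  have tsE : to_sub s xi.1 = to_sub s1 xi.1 by rewrite Ets xb (negPf bd) andbF.
  have pes : perm_eq (to_sub s xi.1 : seq edgeT) (edges_from_into (flat := flat) c ys xi.1).
    rewrite tsE (visited_to_sub vis1) filter_rev perm_rev.
    exact: perm_filter.
  split; first exact/pblk_b.
  split=> //.
  - by rewrite /cls xb (negPf bd) andbF.
  - rewrite tsE (visited_to_sub vis1) /nilp size_filter -lt0n -has_count has_rev.
    by case/(@mapP edgeT): xv => e ev ->; apply/(@hasP edgeT); exists e.
  - move: xib; rewrite mkb => /(visited_mark_cell vis1)[e ev [ex iE]].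
    have : e \in edges_into (flat := flat) c ys by rewrite -(perm_mem visP).
    rewrite mem_filter => /andP[ey eE].
    by exists e; split=> //; rewrite iE Elw // ex xb.
have unm x : pblk s x = b -> x \notin [seq xi.1 | xi <- mark s b] -> val x = v0.
  move=> /pblk_b xb; rewrite mem_mk xb eqxx /= => xv.
  rewrite (unmarked_split_value visP xv).1 v0E.
  by apply: unmarked_value_block; rewrite xb.
have ov0 : observations c v0 by rewrite v0E; apply: unmarked_value_obs.
have H := regroupP wF T_gt0 time_updateP time_cmp3P ys_q q'_new Ps bs cs nmk umk
  mkP unm ov0.
apply: wp_conseq H.
move=> [] s' k [[P' Eq' Epn' Efr'] Epb' Erel' [Emk' Ets' Elw' cs'] lek].
split=> //.
have mem_done z : (z \in sources vis) && (pblk s0 z \in rcons done b) =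
    (z \in [seq xi.1 | xi <- mark s b])
      || ((z \in sources vis) && (pblk s0 z \in done)).
  by rewrite mem_mk mem_rcons inE andb_orr [(_ == _) && _]andbC.
split=> //.
- by move=> x; rewrite Eq'.
- exact: leq_trans Epn Epn'.
- by rewrite Efr'.
- move=> x; rewrite mem_rcons inE negb_or => /andP[/eqP xb xd].
  by rewrite Epb' ?Epb //; apply: contra_not xb => /pblk_b.
- move=> x y; rewrite Erel' Erel mem_rcons inE.
  split=> [[[pxy vxy] vb]|[pxy vxy]].
    by split=> // /orP[/eqP/pblk_b/vb|/vxy].
  by split=> [|/pblk_b xb]; [split=> // xd; apply: vxy; rewrite xd orbT
                            |apply: vxy; rewrite xb eqxx].
- rewrite Emk' Emk; apply/funext => b'; rewrite /set_at mem_rcons inE.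
  by case: (b' == b).
- rewrite Ets' Ets; apply/funext => z; rewrite mem_done.
  by case: (z \in [seq xi.1 | xi <- mark s b]).
- move=> e eE; rewrite mem_rcons inE negb_or => /andP[eb ed].
  by rewrite Elw' ?Elw // mem_mk (negPf eb).
- suff -> : (fun z => if (z \in sources vis) && (pblk s0 z \in rcons done b)
      then nq else oq) = (fun z => if z \in [seq xi.1 | xi <- mark s b] then nq
      else cls z) by [].
  apply/funext => z; rewrite mem_done /cls.
  by case: (z \in [seq xi.1 | xi <- mark s b]).
Qed.

(** The cells of states without edges into [S] were not written, yet they are correct for the new Q
    as well, since the weights of [B] and [B \ S] agree at these states. Blocks that were never
    touched contain only such states, so their states have equal values without any work. *)
Lemma regrouped_end s :
  regrouped [seq bv.1 | bv <- touched s1] s ->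
  [/\ mark s = (fun=> [::]), to_sub s = (fun=> [::]), cells_ok c w (fun=> nq) s &
      forall x y, pblk s x = pblk s y <-> pblk s0 x = pblk s0 y /\ val x = val y].
Proof.
case=> Ps Eq Epn Efr Epb Erel Emk Ets Elw cs.
have done_src z : (z \in sources vis) && (pblk s0 z \in [seq bv.1 | bv <- touched s1])
    = (z \in sources vis).
  rewrite (visited_touched vis1) andb_idr // => zv; apply/nilP => mk0.
  by have := visited_mark vis1 (pblk s0 z) z; rewrite mk0 eqxx zv.
have unsrc x : pblk s0 x \notin [seq bv.1 | bv <- touched s1] -> x \notin sources vis.
  by apply: contra => xv; have := done_src x; rewrite xv.
split.
- rewrite Emk; apply/funext => b; rewrite (visited_touched vis1).
  by case: ifP => // /negbFE/nilP.
- rewrite Ets; apply/funext => z; rewrite done_src.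
  case: ifP => // zv; rewrite (visited_to_sub vis1) -[RHS](filter_pred0 (rev vis)).
  apply: (@eq_in_filter edgeT) => e; rewrite mem_rev => ev.
  by apply: contraFF zv => /eqP <-; apply: (map_f (fun e : edgeT => edge_src e)).
- have cs' : cells_ok c w (fun z => if z \in sources vis then nq else oq) s.
    suff <- : (fun z => if (z \in sources vis) &&
        (pblk s0 z \in [seq bv.1 | bv <- touched s1]) then nq else oq) =
        (fun z => if z \in sources vis then nq else oq) by [].
    by apply/funext => z; rewrite done_src.
  case: cs' => H1 H2 H3.
  have tgtN e : e \in E -> edge_src e \notin sources vis -> edge_tgt e \notin ys.
    move=> eE; apply: contra => ey.
    apply: (map_f (fun e : edgeT => edge_src e)).
    by rewrite (perm_mem visP) mem_filter ey.
  split=> // [e eE|e e' eE e'E].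
    rewrite H2 //; case: ifP => // ev; congr Some.
    have /negPf ey := tgtN _ eE (negbT ev).
    rewrite /new_cls ey.
    case: (eqVneq (oq (edge_tgt e)) q) => [->|eq_].
      rewrite -(unmarked_split_value visP (negbT ev)).2; congr (w _ _).
      apply/funext => y; apply/propext => /=; case: ifP => yy.
        split=> [[]//|qE]; have := q'_new y; by rewrite ys_q // -qE eqxx.
      by split=> [[]|].
    congr (w _ _); apply/funext => y; apply/propext => /=.
    case: ifP => // yy; rewrite (ys_q yy); split=> [qE|q'E].
      by rewrite qE eqxx in eq_.
    by have := q'_new (edge_tgt e); rewrite q'E eqxx.
  rewrite H3 //; case: ifP => // ev.
  split=> -[ee' qE]; split=> //; move: qE; rewrite /new_cls.
    by rewrite !(negPf (tgtN _ _ _)) // -?ee' ev.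
  by rewrite !(negPf (tgtN _ _ _)) // -?ee' ev.
- move=> x y; rewrite Erel; split=> -[pxy vxy]; split=> //.
  case xd: (pblk s0 x \in [seq bv.1 | bv <- touched s1]); first exact: vxy.
  rewrite !(unmarked_split_value visP (unsrc _ _)).1 -?pxy ?xd //.
  exact: unmarked_value_block.
Qed.

End Regroup.

Lemma refine_byP b : pmem s0 b = ys ->
  wp (refine_by M b) (fun _ s' k =>
    [/\ partitions predT s' /\ (forall x, qcls s' x = qcls s0 x),
        (qnum s', pred_edges s', touched s') = (qnum s0, pred_edges s0, [::]),
        [/\ mark s' = (fun=> [::]), to_sub s' = (fun=> [::]) &
            cells_ok c w (fun=> nq) s'],
        (forall x y, pblk s' x = pblk s' y <->
           pblk s0 x = pblk s0 y /\ val x = val y) &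
        k + 72 * (T * potential (fun=> 1) (pblk s')) <=
          72 * (T * potential (fun=> 1) (pblk s0))
          + \sum_(y <- ys) (2 + 83 * (T * size (edges_to (flat := flat) c y))) + 3]) s0.
Proof.
move=> bys; rewrite /refine_by; apply: wp_bind; apply: wp_read; rewrite bys.
apply: wp_bind; apply: wp_conseq visitP => _ s k1 [vs lek1].
set vis := flatten _ in vs.
have visP : perm_eq vis (edges_into (flat := flat) c ys) by apply: perm_edges_into.
apply: wp_bind; apply: wp_read; apply: wp_bind; apply: wp_write.
set td := touched s; set s1 := set_touched _ s.
have td_uniq := visited_touched_uniq vs.
have fr : unchanged_by_visit s1 = unchanged_by_visit s /\
    [/\ to_sub s1 = to_sub s, mark s1 = mark s & touched s1 = [::]].
  by rewrite /s1; case: (s).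
have [] := fr; rewrite (visited_frame vs) => {fr}.
case=> E1 E2 E3 E4 E5 E6 E7 E8 E9 E10 E11 [E12 E13 E14].
have R0 : regrouped vis s [::] s1.
  split=> //.
  - by apply: eq_partitions_fields P0; rewrite E1 E2 E3 E4 E5 E6 E7.
  - by move=> x; rewrite /qcls E2 E5.
  - by rewrite E1.
  - by rewrite E4 E8 E14.
  - by move=> x _; rewrite E2.
  - by move=> x y; rewrite E2; split=> [|[]].
  - by rewrite E12; apply/funext => z; rewrite andbF.
  - by move=> e _ _; rewrite E9.
  - suff -> : (fun z => if (z \in sources vis) && (pblk s0 z \in [::]) then nq else oq)
      = (fun=> oq) by apply: eq_cells_ok cells0.
    by apply/funext => z; rewrite andbF.
have H : wp (for_each td (regroup M)) (fun _ s' k =>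
    regrouped vis s [seq bv.1 | bv <- td] s' /\
    k + 72 * (T * (total_to_sub s' + potential (fun=> 1) (pblk s'))) <=
    72 * (T * (total_to_sub s1 + potential (fun=> 1) (pblk s1)))) s1.
  apply: (wp_for_each (Inv := fun done s' k =>
    regrouped vis s [seq bv.1 | bv <- done] s' /\
    k + 72 * (T * (total_to_sub s' + potential (fun=> 1) (pblk s'))) <=
    72 * (T * (total_to_sub s1 + potential (fun=> 1) (pblk s1))))).
    by split.
  move=> done [b' v0] todo s2 k2 Etd [R2 lek2].
  have b'd : b' \notin [seq bv.1 | bv <- done].
    move: td_uniq; rewrite -/td Etd map_cat cat_uniq => /and3P[_ /hasPn/(_ b')].
    by rewrite /= mem_head => /(_ isT).
  have b't : (b', v0) \in (touched s : seq (nat * value)).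
    by rewrite -/td Etd; apply: (@mem_cat_head (nat * value)%type).
  apply: wp_conseq (regrouped_step visP vs R2 b'd b't) => _ s3 k3 [R3 lek3].
  rewrite map_rcons; split=> //.
  by move: lek2 lek3; do 3![move: (72 * _)]; clear; lia.
apply: wp_conseq H => _ s' k2 [R' lek2].
have [H1 H2 H3 H4] := regrouped_end visP vs R'.
have [P' Eq' _ Efr' _ _ _ _ _ _] := R'.
split=> //.
(* After the visits the lists [to_sub] hold each visited edge once. Together with the 11 of
   [visit_edgeP], the 72 of [regroupP] gives 83 per edge. *)
have tot1 : total_to_sub s1 = \sum_(y <- ys) size (edges_to (flat := flat) c y).
  rewrite /total_to_sub E12.
  transitivity (size vis); last first.
    by rewrite /vis size_flatten /shape -map_comp sumnE big_map.
  rewrite -(size_map (fun e : edgeT => edge_src e)).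
  rewrite (size_sum_count (enum_uniq C) (fun x _ => mem_enum C x)) big_enum /=.
  apply: eq_bigr => x _; rewrite (visited_to_sub vs) filter_rev size_rev size_filter.
  by rewrite count_map.
rewrite tot1 E2 in lek2.
rewrite !sum_affine in lek1 *.
move: lek1 lek2; rewrite !mulnDr.
move: (T * potential _ _) (T * potential _ _) (T * total_to_sub _) (T * \sum_(_ <- _) _).
by move: (size ys); clear; lia.
Qed.

End RefineBy.

(** * The main loop *)

(** [r] and [p] are the potentials of Q and P; [n] states with [e] incoming edges move to a smaller
    block of Q. The edges use up [83 * (t * e)], and since [n] is positive, [83 * (t * n)] covers
    the remaining [14 + 2 * n]. *)
Lemma measure_decrease t n e p p' r r' k :
  0 < t -> 0 < n -> r' + (n + e) <= r ->
  k + 72 * (t * p') <= 72 * (t * p) + (2 * n + 83 * (t * e)) + 3 ->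
  11 + k + t * (83 * r' + 72 * p') <= t * (83 * r + 72 * p).
Proof.
move=> t_gt0 n_gt0 /(leq_mul (leqnn t)).
have : t <= t * n by rewrite leq_pmulr.
have : n <= t * n by rewrite leq_pmull.
by lia.
Qed.

Section MainLoop.
Context {F : set_functor} {A : Type} {flat : encoding F A}.
Context {I : refinement_interface flat} (M : implementation I) {C : finType}.
Variable c : C -> F C.
Variable w : forall X : Type, set X -> F X -> weight I.
Hypothesis wF : weight_family flat (init I) (@update _ _ _ I) w.
Variable T : nat.
Hypothesis T_gt0 : 0 < T.
Hypothesis time_updateP : forall x (S B : set C), (S `<=` B)%classic ->
  time_update M (labels_into (flat (c x)) S) (w B (c x))
    <= T * maxn 1 (bag_size (labels_into (flat (c x)) S)).
Hypothesis time_cmp3P : forall u v, observations c u -> observations c v ->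
  time_cmp3 M u v <= T.
Hypothesis zipF : zippable F.

Local Notation store := (memory F A (weight I) C).

Record loop_inv (s : store) : Prop := LoopInv {
  inv_partitions : partitions predT s;
  inv_pred_edges : pred_edges s = edges_to (flat := flat) c;
  inv_to_sub : to_sub s = (fun=> [::]);
  inv_mark : mark s = (fun=> [::]);
  inv_touched : touched s = [::];
  inv_cells : cells_ok c w (fun=> qcls s) s;
  inv_stable : forall x y, pblk s x = pblk s y ->
    fmap (qcls s) (c x) = fmap (qcls s) (c y);
  inv_coarse : forall x y, behaviourally_equivalent c x y -> pblk s x = pblk s y
}.

Definition degree (y : C) : nat := 1 + size (edges_to (flat := flat) c y).

(** Bounds the steps that remain before the final test of the loop. *)
Definition measure (s : store) : nat :=
  T * (83 * potential degree (qcls s) + 72 * potential (fun=> 1) (pblk s)).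

Lemma potential_split (g f : C -> nat) (ys : seq C) q' :
  uniq ys -> ~~ nilp ys -> (forall y, f y != q') ->
  (forall y, y \in ys -> 2 * size ys <= class_size f y) ->
  potential g (new_cls ys f q') + \sum_(y <- ys) g y <= potential g f.
Proof.
move=> uys nys fq' big_ys.
rewrite big_uniq //= [X in _ + X]big_mkcond /potential -big_split /=.
apply: leq_sum => y _; case: ifP => yys; last first.
  rewrite addn0 leq_mul // leq_trunc_log //; apply/subset_leq_card/fintype.subsetP => z.
  rewrite !inE /new_cls yys; case: ifP => // _ /eqP E.
  by have := fq' y; rewrite -E eqxx.
rewrite addnC -mulnS leq_mul //.
have ys_gt0 : 0 < size ys by rewrite lt0n.
(* Doubling raises [tl] by exactly one, so the halving of the block is not lost in the rounding. *)
apply: leq_trans (leq_trunc_log 2 (big_ys _ yys)).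
rewrite mul2n trunc_log2_double // ltnS leq_trunc_log //.
apply: leq_trans (card_size ys); apply/subset_leq_card/fintype.subsetP => z.
rewrite !inE /new_cls yys; case: ifP => // _ /eqP E.
by have := fq' z; rewrite E eqxx.
Qed.

Lemma refine_stepP (s : store) :
  loop_inv s -> ~~ nilp (work s) ->
  wp (refine_step M) (fun _ s' k => loop_inv s' /\ 1 + k + measure s' <= measure s) s.
Proof.
move=> inv_s nwk.
have [Ps Epe Ets Emk Etd cs stab coarse] := inv_s.
have [Hpu Hpn Hpm Hpl Hqu Hqm Hql Hwu Hwm] := Ps.
case Ewk: (work s) nwk => [//|q wk] _.
have : q \in work s by rewrite Ewk mem_head.
rewrite Hwm => /andP[qlt]; case Eqm: (qmem s q) => [|b1 [|b2 bs]] // _.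
(* Stated up to permutation, so as to serve both outcomes of the comparison of sizes. The 5 counts
   the loop test and the four reads before the choice; at most six more steps precede
   [refine_by]. *)
have key b b' : perm_eq [:: b, b' & bs] (qmem s q) ->
    size (pmem s b) <= size (pmem s b') ->
  wp (put_qmem q (b' :: bs) ;;;
      let* q' := read (@qnum _ _ _ _) in
      write (set_qnum q'.+1) ;;;
      put_qmem q' [:: b] ;;;
      put_qblk b q' ;;;
      when (nilp bs) (write (set_work wk)) ;;;
      refine_by M b)
    (fun _ s' k => loop_inv s' /\ 5 + k + measure s' <= measure s) s.
  move=> pbs le_b.
  have [bq b'q] : b \in qmem s q /\ b' \in qmem s q.
    by rewrite -!(perm_mem pbs) !inE !eqxx orbT.
  have [blt qb] : b < pnum s /\ qblk s b = q.
    by move: bq; rewrite Hqm // => /andP[-> /eqP].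
  have [b'lt qb'] : b' < pnum s /\ qblk s b' = q.
    by move: b'q; rewrite Hqm // => /andP[-> /eqP].
  have ubs : uniq [:: b, b' & bs] by rewrite (perm_uniq pbs) Hqu.
  have bNbs : b \notin b' :: bs by case/andP: ubs.
  pose wk' := if nilp bs then wk else q :: wk.
  (* In [s0] the partition Q is already split, while the cells and the stability of P still refer to
     the old one. Hence [refine_byP] is applied with [qcls s] as old partition, and [qcls s0] is the
     new one. *)
  pose s0 : store := Memory (pnum s) (pblk s) (pmem s) (qnum s).+1
    (set_at (qblk s) b (qnum s))
    (set_at (set_at (qmem s) q (b' :: bs)) (qnum s) [:: b]) wk'
    (pred_edges s) (to_sub s) (last_w s) (cnum s) (cell s) (mark s) (touched s).
  suff H : wp (refine_by M b)
     (fun _ s' k => loop_inv s' /\ 11 + k + measure s' <= measure s) s0.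
    apply: wp_bind; apply: wp_write; apply: wp_bind; apply: wp_read.
    apply: wp_bind; apply: wp_write; apply: wp_bind; apply: wp_write.
    apply: wp_bind; apply: wp_write; apply: wp_bind.
    rewrite /s0 /wk' in H; rewrite -Ewk in H.
    case: (s) H => pn pb pm qn qbl qm wk0 pe ts lw cn cl mk td /=.
    case: (nilp bs) => H.
      by apply: wp_write => /=; apply: wp_conseq H => _ s' k [inv' le']; split.
    apply: wp_ret => /=; apply: wp_conseq H => _ s' k [inv' le']; split=> //.
    by move: le'; do 2![move: (measure _)]; clear; lia.
  have qqn : (q == qnum s) = false by rewrite ltn_eqF.
  pose ys := pmem s b.
  have ysE y : (y \in ys) = (pblk s y == b) by rewrite /ys Hpm.
  have oq_lt y : qcls s y < qnum s by rewrite Hql // Hpl.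
  have oq_new y : qcls s y != qnum s by rewrite ltn_eqF.
  have ys_q y : y \in ys -> qcls s y = q by rewrite ysE /qcls => /eqP ->.
  have nqE : qcls s0 = new_cls ys (qcls s) (qnum s).
    apply/funext => y; rewrite /new_cls ysE /qcls /= /set_at.
    by case: eqP.
  have P0 : partitions predT s0.
    split=> //=.
    - move=> q1; rewrite ltnS leq_eqVlt /set_at; case: eqP => //= _ q1lt.
      by case: eqP => _; [case/andP: ubs|apply: Hqu].
    - move=> q1 b0; rewrite ltnS leq_eqVlt /set_at.
      case: (eqVneq q1 (qnum s)) => [-> _|q1n /= q1lt].
        rewrite inE; case: (eqVneq b0 b) => [->|b0b]; first by rewrite eqxx blt.
        by case b0lt: (b0 < pnum s) => //=; rewrite ltn_eqF // Hql.
      case: (eqVneq q1 q) => [->|q1q].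
        case: (eqVneq b0 b) => [->|b0b].
          by rewrite (negPf bNbs) eq_sym qqn andbF.
        by rewrite -Hqm // -(perm_mem pbs) [RHS]inE (negPf b0b).
      rewrite Hqm //; case: (eqVneq b0 b) => [->|//].
      by rewrite qb [qnum s == _]eq_sym (negPf q1n) [q == _]eq_sym (negPf q1q).
    - move=> b0 b0lt; rewrite /set_at; case: eqP => // _.
      by rewrite ltnS ltnW // Hql.
    - rewrite /wk'; case: ifP => // _; first by move: Hwu; rewrite Ewk => /andP[].
      by rewrite -Ewk.
    - move=> q1; rewrite ltnS leq_eqVlt /set_at.
      have q_wk : q \notin wk by move: Hwu; rewrite Ewk => /andP[].
      have mem_wk q2 : (q2 \in wk) = (q2 != q) && (q2 < qnum s) && (1 < size (qmem s q2)).
        have := Hwm q2; rewrite Ewk inE; case: (eqVneq q2 q) => [->|_ /= ->//].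
        by rewrite (negPf q_wk).
      case: (eqVneq q1 (qnum s)) => [->|q1n] /=.
        rewrite /wk'; case: ifP => _; rewrite ?inE mem_wk ltnn andbF //.
        by rewrite [qnum s == q]eq_sym qqn.
      rewrite /wk'; case: (eqVneq q1 q) => [->|q1q].
        case: ifP => [/nilP ->|nbs]; first by rewrite (negPf q_wk) andbF.
        by rewrite mem_head qlt /=; case: (bs) nbs.
      by case: ifP => _; rewrite ?inE mem_wk ?q1q ?(negPf q1q).
  have cells0 : cells_ok c w (fun=> qcls s) s0 by apply: eq_cells_ok cs.
  have H := refine_byP wF T_gt0 time_updateP time_cmp3P (Hpu _ blt) ys_q oq_new P0
    Epe Ets Emk Etd cells0 stab (erefl : pmem s0 b = ys).
  apply: wp_conseq H => _ s' k [[P' Eq'] Efr [Emk' Ets' cs'] Erel lek].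
  case: Efr => Eqn' Epe' Etd'.
  have qcls' : qcls s' = new_cls ys (qcls s) (qnum s).
    by rewrite -nqE; apply/funext => x; apply: Eq'.
  split.
    split=> //.
    - by rewrite Epe'.
    - by rewrite qcls'.
    - move=> x y /Erel[/= pxy vxy]; rewrite qcls'.
      have := zippable_split (S := [set y | y \in ys]%classic) (qnum s) zipF
        ys_q (stab _ _ pxy) vxy.
      suff -> : (fun y => if `[< [set y | y \in ys]%classic y >] then qnum s else qcls s y)
        = new_cls ys (qcls s) (qnum s) by [].
      by apply/funext => z; rewrite asboolb.
    - move=> x y xy; apply/Erel; split; first exact: coarse.
      apply: (behaviour_fmap zero3) xy => x' y' /coarse pxy.
      by rewrite /chi /= !ysE /qcls pxy.
  have nys : ~~ nilp ys by apply: Hpn.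
  have big_ys y : y \in ys -> 2 * size ys <= class_size (qcls s) y.
    move=> yys; rewrite mul2n -addnn; apply: (@leq_trans (size (ys ++ pmem s b'))).
      by rewrite size_cat leq_add2l.
    have /card_uniqP <- : uniq (ys ++ pmem s b').
      rewrite cat_uniq !Hpu // andbT; apply/hasPn => z; rewrite ysE Hpm //= => /eqP ->.
      by move: bNbs; rewrite inE negb_or eq_sym => /andP[].
    apply/subset_leq_card/fintype.subsetP => z; rewrite mem_cat inE (ys_q _ yys).
    case/orP=> [/ys_q -> //|]; rewrite Hpm //= /qcls => /eqP ->.
    by rewrite qb'.
  have pot := potential_split degree (Hpu _ blt) nys oq_new big_ys.
  have sumE : \sum_(y <- ys) degree y =
      size ys + \sum_(y <- ys) size (edges_to (flat := flat) c y).
    by rewrite big_split /= sum1_size.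
  rewrite -/ys sumE -qcls' in pot; rewrite sum_affine /= in lek.
  have ys_gt0 : 0 < size ys by rewrite lt0n.
  exact: measure_decrease T_gt0 ys_gt0 pot lek.
rewrite /refine_step.
apply: wp_bind; apply: wp_read; rewrite Ewk.
apply: wp_bind; apply: wp_read; rewrite Eqm.
apply: wp_bind; apply: wp_read; apply: wp_bind; apply: wp_read.
case: leqP => le12.
  have H := key b1 b2; rewrite Eqm in H.
  by apply: wp_conseq (H (perm_refl _) le12) => _ s' k [inv' le']; split.
have p21 : perm_eq [:: b2, b1 & bs] (qmem s q).
  by rewrite Eqm -[b2 :: _]/([:: b2] ++ [:: b1] ++ bs) perm_catCA.
by apply: wp_conseq (key b2 b1 p21 (ltnW le12)) => _ s' k [inv' le']; split.
Qed.

(** Termination comes with the cost bound: an iteration lowers the measure by at least the steps it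
    takes, including the positive cost of the loop test. *)
Lemma loopP (s : store) : loop_inv s ->
  exists s' k, [/\ while_run (fun s => ~~ nilp (work s)) (refine_step M) s s' k,
    loop_inv s', nilp (work s') & k <= 1 + measure s].
Proof.
move: {2}(measure s) (leqnn (measure s)) => n; elim: n s => [|n IH] s sn inv_s.
all: case nwk: (nilp (work s)); first by exists s, 1; split=> //; apply: WhileDone; rewrite nwk.
all: have [[] [s1 [k1 [E1 [inv1 le1]]]]] := wpP (refine_stepP inv_s (negbT nwk)).
  by exfalso; move: le1; rewrite (eqP (_ : measure s == 0)) -?leqn0 //.
have [|s' [k [run' inv' nwk' le']]] := IH s1 _ inv1; first by move: sn le1; lia.
exists s', (1 + k1 + k); split=> //; first by apply: WhileStep E1 run'; rewrite nwk.
by move: le1 le'; lia.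
Qed.

Lemma loop_inv_end (s : store) : loop_inv s -> nilp (work s) ->
  forall x y, pblk s x = pblk s y <-> behaviourally_equivalent c x y.
Proof.
case=> Ps _ _ _ _ _ stab coarse wk0 x y; split; last exact: coarse.
have [Hpu Hpn Hpm Hpl Hqu Hqm Hql Hwu Hwm] := Ps.
(* With an empty worklist every block of Q consists of a single block of P, so stability with
   respect to Q becomes stability with respect to P. *)
have qp x' y' : qcls s x' = qcls s y' -> pblk s x' = pblk s y'.
  move=> qxy; have qlt : qcls s x' < qnum s by rewrite Hql // Hpl.
  have : qcls s x' \in work s = false by rewrite (nilP wk0).
  rewrite Hwm qlt /= => /negbT; rewrite -leqNgt.
  have : pblk s x' \in qmem s (qcls s x') by rewrite Hqm // Hpl //=.
  have : pblk s y' \in qmem s (qcls s x') by rewrite Hqm // Hpl //= -/(qcls s y') qxy.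
  case: (qmem s _) => [|b [|b2 l]] //.
  by rewrite !inE => /eqP -> /eqP ->.
apply: (quotient_behaviour (f := pblk s)) => x' y' pxy.
exact: (fmap_factor 0 qp (stab _ _ pxy)).
Qed.

End MainLoop.

(** * Initialization *)

Section Initialization.
Context {F : set_functor} {A : Type} {flat : encoding F A}.
Context {I : refinement_interface flat} (M : implementation I) {C : finType}.
Variable c : C -> F C.
Variable w : forall X : Type, set X -> F X -> weight I.
Hypothesis wF : weight_family flat (init I) (@update _ _ _ I) w.
Variable T : nat.
Hypothesis T_gt0 : 0 < T.
Hypothesis time_initP : forall x,
  time_init M (type_of c x) (labels (flat (c x)))
    <= T * maxn 1 (bag_size (labels (flat (c x)))).
Hypothesis time_cmp3P : forall u v, observations c u -> observations c v ->
  time_cmp3 M u v <= T.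

Local Notation value := {classic (F 'I_3)}.
Local Notation group := (value * seq C)%type.
Local Notation store := (memory F A (weight I) C).
Local Notation edgeT := {classic (edge A C)}.
Local Notation E := (edges (flat := flat) c : seq edgeT).

Definition out_edges (x : C) : seq edgeT := [seq e <- rev E | edge_src e == x].

Definition edge_memory pe ts lw cn cl : store :=
  Memory 0 (fun=> 0) (fun=> [::]) 0 (fun=> 0) (fun=> [::]) [::]
         pe ts lw cn cl (fun=> [::]) [::].

Lemma add_edgesP :
  wp (for_each E add_edge) (fun _ s k =>
    s = edge_memory (edges_to (flat := flat) c) out_edges (fun=> 0) 0 (fun=> None) /\
    k = 5 * size E) empty_memory.
Proof.
apply: (wp_for_each (Inv := fun (done : seq edgeT) s k =>
  s = edge_memory (fun y => [seq e <- rev done | edge_tgt (e : edgeT) == y])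
    (fun x => [seq e <- rev done | edge_src (e : edgeT) == x]) (fun=> 0) 0 (fun=> None) /\
  k = 5 * size done)) => //.
move=> done e todo s k _ [-> ->].
apply: wp_bind; apply: wp_read; apply: wp_bind; apply: wp_write.
apply: wp_bind; apply: wp_read; apply: wp_write; split.
  rewrite rev_rcons /edge_memory; congr Memory; apply/funext => z /=; rewrite /set_at eq_sym.
    by case: eqP => [->|].
  by case: eqP => [->|].
by rewrite size_rcons mulnS addnC.
Qed.

Record initialized (done : seq C) (s : store) : Prop := Initialized {
  initialized_frame : s = edge_memory (edges_to (flat := flat) c)
    (fun x => if x \in done then [::] else out_edges x) (last_w s) (cnum s) (cell s);
  initialized_lt : forall e, e \in E -> edge_src e \in done ->
    last_w s (edge_id e) < cnum s;
  initialized_cell : forall e, e \in E -> edge_src e \in done ->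
    cell s (last_w s (edge_id e)) = Some (w setT (c (edge_src e)));
  initialized_eq : forall e e', e \in E -> e' \in E -> edge_src e \in done ->
    edge_src e' \in done ->
    last_w s (edge_id e) = last_w s (edge_id e') <-> edge_src e = edge_src e'
}.

Lemma init_weightsP done s x : initialized done s -> x \notin done ->
  wp (init_weights M c x) (fun _ s' k => initialized (rcons done x) s' /\
    1 + k <= T * (7 + 4 * size (out_edges x))) s.
Proof.
case=> -> /=; move: (last_w s) (cnum s) (cell s) => lw cn cl Hlt Hcell Heq xd.
have es_perm : perm_eq (out_edges x) [seq e <- E | edge_src e == x].
  by rewrite /out_edges filter_rev perm_rev.
have lab : label_bag (out_edges x) = labels (flat (c x)) := label_bag_all es_perm.
rewrite /init_weights; apply: wp_bind; apply: wp_read; rewrite /= (negPf xd).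
apply: wp_bind; apply: wp_call; rewrite lab (wF (c x)).1.
apply: wp_bind; apply: wp_bind; apply: wp_read; apply: wp_bind; apply: wp_write.
apply: wp_bind; apply: wp_write; apply: wp_ret => /=.
apply: wp_bind; apply: for_each_last_w; apply: wp_write => /=.
have lwE e : e \in E ->
    (if edge_id e \in [seq edge_id e | e <- out_edges x] then cn else lw (edge_id e)) =
    if edge_src e == x then cn else lw (edge_id e).
  move=> eE; congr (if _ then _ else _).
  apply/(@mapP edgeT)/idP => [[e' + ee']|ex]; last first.
    by exists e => //; rewrite mem_filter ex mem_rev.
  by rewrite mem_filter mem_rev => /andP[e'x e'E]; rewrite (edge_id_inj eE e'E ee').
have memE z : (z \in rcons done x) = (z == x) || (z \in done) by rewrite mem_rcons inE.
split.
  split=> /=.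
  - rewrite /edge_memory; congr Memory; apply/funext => z; rewrite memE /set_at.
    by case: (z == x).
  - move=> e eE; rewrite lwE // memE; case: eqP => //= _ ed.
    exact: leq_trans (Hlt _ eE ed) _.
  - move=> e eE; rewrite lwE // memE /set_at; case: (eqVneq (edge_src e) x) => [->|ex /= ed].
      by rewrite eqxx.
    by rewrite (ltn_eqF (Hlt _ eE ed)) Hcell.
  - move=> e e' eE e'E; rewrite !lwE // !memE.
    case: (eqVneq (edge_src e) x) => [->|ex]; case: (eqVneq (edge_src e') x) => [->|e'x] //=.
    + move=> _ e'd; split=> [cnE|xE]; first by have := Hlt _ e'E e'd; rewrite -cnE ltnn.
      by rewrite xE eqxx in e'x.
    + move=> ed _; split=> [cnE|xE]; first by have := Hlt _ eE ed; rewrite cnE ltnn.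
      by rewrite xE eqxx in ex.
    + exact: Heq.
have := time_initP x; rewrite -lab /label_bag bag_size_of size_map.
set t := time_init _ _ _; clearbody t; move: (size (out_edges x)) T_gt0; clear => n T_gt0.
have : n <= T * n by rewrite leq_pmull.
have : T * maxn 1 n <= T * (1 + n) by rewrite leq_mul //; lia.
by lia.
Qed.

Lemma type3E x : type3 c x = fmap (fun=> zero3) (c x).
Proof. by rewrite /type3 /type_of -fmap_comp. Qed.

(** Brings the initial sorting, which is by values in F 1, under the time bound for comparisons of
    observed values in F 3. *)
Lemma type3_obs x : observations c (type3 c x).
Proof.
exists x, set0, set0; split=> //; rewrite type3E; congr fmap.
by apply/funext => y; rewrite /chi !asboolF.
Qed.

Record blocks_added (done : seq group) (s0 s : store) : Prop := BlocksAdded {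
  added_partitions : partitions (fun x => x \in states done) s;
  added_rest : rest s = rest s0;
  added_rel : forall x y, x \in states done -> y \in states done ->
    pblk s x = pblk s y <-> type3 c x = type3 c y
}.

Lemma add_blocksP (s : store) (r : seq group) :
  pnum s = 0 -> qnum s = 1 -> qmem s = (fun=> [::]) -> work s = [::] ->
  uniq [seq h.1 | h <- r] ->
  (forall h, h \in r -> [/\ uniq h.2, ~~ nilp h.2 &
     forall y, y \in h.2 -> type3 c y = h.1]) ->
  wp (for_each r (fun g => new_block 0 g.2)) (fun _ s' k =>
    blocks_added r s s' /\ k <= 11 * size (states r)) s.
Proof.
move=> Epn Eqn Eqm Ewk ur rP.
apply: (wp_for_each (Inv := fun (done : seq group) s' k =>
  blocks_added done s s' /\ k <= 11 * size (states done))).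
  split=> //; split=> //; split; rewrite ?Epn ?Eqn ?Eqm ?Ewk //.
  by move=> q; rewrite andbF.
move=> done h todo s' k Er [[P' Er' rel'] lek].
have hr : h \in r by rewrite Er; apply: mem_cat_head.
have [uh nh hP] := rP _ hr.
have disj x : x \in h.2 -> x \notin states done.
  move=> /hP xh; apply/negP => /mem_states[h' h'd xh'].
  have h'r : h' \in r by rewrite Er mem_cat h'd.
  have [_ _ /(_ x xh') hh'] := rP _ h'r.
  move: ur; rewrite Er map_cat cat_uniq => /and3P[_ /hasPn/(_ h.1)].
  rewrite /= mem_head => /(_ isT) /negP[].
  by rewrite -xh hh'; apply: (map_f (fun h : group => h.1)).
have q0 : 0 < qnum s' by case: Er' => ->; rewrite Eqn.
apply: wp_conseq (new_blockP P' uh nh disj q0).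
move=> [] s'' k' [P'' Er'' Epn'' [Epb _] lek'].
have statesE x : (x \in states (rcons done h)) = (x \in states done) || (x \in h.2).
  by rewrite /states map_rcons -cats1 flatten_cat /= cats0 mem_cat.
split.
  split.
  - by apply: eq_partitions P'' => x; rewrite statesE.
  - by rewrite Er''.
  - have lt x : x \in states done -> pblk s' x < pnum s' by apply: (pblk_lt P').
    have ne x y : x \in states done -> y \in h.2 -> type3 c x <> type3 c y.
      move=> /mem_states[h' h'd xh'] yh xy.
      have h'r : h' \in r by rewrite Er mem_cat h'd.
      have [_ _ /(_ x xh') hh'] := rP _ h'r.
      move: ur; rewrite Er map_cat cat_uniq => /and3P[_ /hasPn/(_ h.1)].
      rewrite /= mem_head => /(_ isT) /negP[].
      by rewrite -(hP _ yh) -xy hh'; apply: (map_f (fun h : group => h.1)).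
    move=> x y; rewrite !statesE !Epb.
    case xh: (x \in h.2); case yh: (y \in h.2); rewrite ?orbF => xd yd.
    + by rewrite !hP.
    + split=> [pE|xy]; first by have := lt _ yd; rewrite -pE ltnn.
      by case: (ne _ _ yd xh).
    + split=> [pE|xy]; first by have := lt _ xd; rewrite pE ltnn.
      by case: (ne _ _ xd yh).
    + exact: rel'.
move: nh lek lek'; rewrite /states map_rcons -cats1 flatten_cat size_cat /= cats0 /nilp.
by clear; lia.
Qed.

Lemma initializeP :
  wp (initialize M c) (fun _ s k => loop_inv c w s /\
    k <= T * (9 * size E + 40 * #|C| + 21 + 20 * (#|C| * tl #|C|))) empty_memory.
Proof.
rewrite /initialize.
apply: wp_bind; apply: wp_conseq add_edgesP => _ _ _ [-> ->].
set s1 := edge_memory _ _ _ _ _.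
have H : wp (for_each (enum C) (init_weights M c)) (fun _ s k =>
    initialized (enum C) s /\
    k <= \sum_(x <- enum C) T * (7 + 4 * size (out_edges x))) s1.
  apply: (wp_for_each (Inv := fun done s k => initialized done s /\
    k <= \sum_(x <- done) T * (7 + 4 * size (out_edges x)))).
    by split=> //; split.
  move=> done x todo s k Ee [ini lek].
  have xd : x \notin done.
    have := enum_uniq C; rewrite Ee cat_uniq => /and3P[_ /hasPn/(_ x)].
    by rewrite mem_head => /(_ isT).
  apply: wp_conseq (init_weightsP ini xd) => _ s' k' [ini' lek'].
  by split=> //; rewrite -cats1 big_cat big_seq1 /= leq_add.
apply: wp_bind; apply: wp_conseq H => _ s2 k2 [ini2 lek2].
have H : wp (collect (enum C) (fun x => ret (Some (type3 c x, x)))) (fun vs s k =>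
    [/\ s = s2, vs = [seq (type3 c x : value, x) | x <- enum C] & k = #|C|]) s2.
  rewrite cardE; apply: (wp_collect (Inv := fun done vs s k =>
    [/\ s = s2, vs = [seq (type3 c x : value, x) | x <- done] & k = size done])) => //.
  move=> done x todo vs s k _ [-> -> ->]; apply: wp_ret.
  by rewrite map_rcons size_rcons addn0 addn1.
apply: wp_bind; apply: wp_conseq H => _ _ _ [-> -> ->].
set vs := map _ _.
have uvs : uniq [seq vx.2 | vx <- vs] by rewrite -map_comp map_id_in ?enum_uniq.
have Ovs : all (fun v : value => `[< observations c v >]) [seq vx.1 | vx <- vs].
  by rewrite -map_comp all_map; apply/allP => x _ /=; apply/asboolP/type3_obs.
have obs_time u v : `[< observations c u >] -> `[< observations c v >] ->
    time_cmp3 M u v <= T.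
  by move=> /asboolP ou /asboolP; apply: time_cmp3P.
apply: wp_bind; apply: wp_conseq (group_byP s2 T_gt0 obs_time Ovs).
move=> r0 _ k3 [-> sr pr lek3].
move: (r0 : seq group) sr pr lek3 => r {r0} sr pr lek3.
have szvs : size vs = #|C| by rewrite size_map cardE.
have upr : uniq (pairs r) by rewrite (perm_uniq pr); apply: map_uniq uvs.
apply: wp_bind; apply: wp_write.
set s3 := set_qnum 1 s2.
have [fr3 cells3] : [/\ pnum s3 = 0, qnum s3 = 1, qmem s3 = (fun=> [::]), work s3 = [::] &
    rest s3 = (1, edges_to (flat := flat) c, (fun=> [::]), last_w s2, cnum s2, cell s2,
               (fun=> [::]), [::])] /\ cells_ok c w (fun=> fun=> 0) s2.
  split; last first.
    case: ini2 => _ H1 H2 H3; split.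
    - by move=> e eE; apply: H1; rewrite ?mem_enum.
    (* Q starts with one block, so the weight of all states computed by [init] is the weight of the
       block of every target. *)
    - move=> e eE; rewrite H2 ?mem_enum //; congr (Some (w _ _)).
      by apply/funext => y; apply/propext.
    - by move=> e e' eE e'E; rewrite H3 ?mem_enum //; split=> [|[]].
  rewrite /s3 (initialized_frame ini2) /=; split=> //; rewrite /rest /=.
  rewrite (_ : (fun x => if x \in enum C then [::] else out_edges x) = (fun=> [::])) //.
  by apply/funext => x; rewrite mem_enum.
have [Epn3 Eqn3 Eqm3 Ewk3 Er3] := fr3.
have rP h : h \in r -> [/\ uniq h.2, ~~ nilp h.2 & forall y, y \in h.2 -> type3 c y = h.1].
  move=> hr; have nh : ~~ nilp h.2 by case/andP: sr => _ /allP/(_ _ hr).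
  split=> //; first exact: uniq_group upr hr.
  by move=> y; rewrite (mem_group _ sr hr) (perm_mem pr) => /mapP[x _ [-> ->]].
apply: wp_conseq (add_blocksP Epn3 Eqn3 Eqm3 Ewk3 (uniq_keys sr) rP).
move=> _ s4 k4 [[P4 Er4 rel4] lek4].
have all_states x : x \in states r.
  have : (type3 c x : value, x) \in pairs r.
    rewrite (perm_mem pr); apply: (map_f (fun x => (type3 c x : value, x))).
    by rewrite mem_enum.
  move=> xr; have /mapP[h hr vE] := mem_keys xr.
  by apply/mem_states; exists h => //; rewrite (mem_group _ sr hr) -vE.
move: Er4; rewrite Er3 => -[Eqn4 Epe4 Ets4 Elw4 Ecn4 Ecl4 Emk4 Etd4].
have Pall : partitions predT s4.
  by apply: eq_partitions P4 => x; rewrite all_states.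
have qcls4 : qcls s4 = (fun=> 0).
  apply/funext => x; have := qblk_lt Pall (pblk_lt Pall (isT : predT x)).
  by rewrite Eqn4 ltnS leqn0 => /eqP.
split.
  split=> //.
  - by rewrite qcls4; apply: eq_cells_ok cells3.
  - move=> x y /(rel4 _ _ (all_states _) (all_states _)).
    by rewrite qcls4 !type3E; apply: (fmap_factor 0).
  - move=> x y xy; apply/rel4 => //; rewrite !type3E.
    exact: (behaviour_fmap zero3) xy.
(* No earlier partition can pay for this grouping, so each drop of the logarithm is bounded by
   [tl #|C|]; this happens only once. *)
have ent : \sum_(h <- r) size h.2 * (tl (size vs) - tl (size h.2)) <= #|C| * tl #|C|.
  have -> : #|C| * tl #|C| = \sum_(h <- r) size h.2 * tl (size vs).
    rewrite -big_distrl /= szvs; congr muln.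
    rewrite -szvs -(perm_size pr) /pairs size_flatten /shape -map_comp sumnE big_map.
    by apply: eq_bigr => h _ /=; rewrite size_map.
  by apply: leq_sum => h _; rewrite leq_mul // leq_subr.
have size_st : size (states r) = #|C|.
  rewrite -szvs -(perm_size pr) /states /pairs !size_flatten /shape -!map_comp; congr sumn.
  by apply: eq_map => h /=; rewrite size_map.
have out_sum : \sum_(x <- enum C) size (out_edges x) = size E.
  rewrite big_enum /= -(size_map (fun e : edgeT => edge_src e)).
  rewrite (size_sum_count (enum_uniq C) (fun x _ => mem_enum C x)) big_enum /=.
  apply: eq_bigr => x _; rewrite /out_edges filter_rev size_rev size_filter.
  by rewrite count_map.
have k2E : \sum_(x <- enum C) T * (7 + 4 * size (out_edges x)) =
    T * (7 * #|C| + 4 * size E).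
  rewrite -big_distrr big_split /= -big_distrr /= out_sum; congr (_ * (_ + _)).
  by rewrite big_const_seq count_predT -cardE iter_addn_0.
have {}lek3 : k3 <= 20 * T * (1 + #|C| + #|C| * tl #|C|).
  by apply: leq_trans lek3 _; rewrite leq_mul2l leq_add ?ent ?orbT // szvs.
move: lek2 lek3 lek4 T_gt0; rewrite k2E size_st.
move: (#|C| * tl #|C|) #|C| (size E); clear => f n m lek2 lek3 lek4 T_gt0.
have : n <= T * n by rewrite leq_pmull.
have : m <= T * m by rewrite leq_pmull.
by lia.
Qed.

End Initialization.

(** * Total running time *)

Lemma potential_le (C : finType) (g f : C -> nat) :
  potential g f <= (\sum_x g x) * tl #|C|.
Proof.
rewrite big_distrl /=; apply: leq_sum => x _.
by rewrite leq_mul // leq_trunc_log // max_card.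
Qed.

Section TotalTime.
Context {F : set_functor} {A : Type} {flat : encoding F A}.
Context {I : refinement_interface flat} (M : implementation I) {C : finType}.
Variable c : C -> F C.
Variable w : forall X : Type, set X -> F X -> weight I.
Hypothesis wF : weight_family flat (init I) (@update _ _ _ I) w.
Variable T : nat.
Hypothesis T_gt0 : 0 < T.
Hypothesis time_initP : forall x,
  time_init M (type_of c x) (labels (flat (c x)))
    <= T * maxn 1 (bag_size (labels (flat (c x)))).
Hypothesis time_updateP : forall x (S B : set C), (S `<=` B)%classic ->
  time_update M (labels_into (flat (c x)) S) (w B (c x))
    <= T * maxn 1 (bag_size (labels_into (flat (c x)) S)).
Hypothesis time_cmp3P : forall u v, observations c u -> observations c v ->
  time_cmp3 M u v <= T.
Hypothesis zipF : zippable F.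
Local Notation edgeT := {classic (edge A C)}.

Lemma sum_degree :
  \sum_x degree (flat := flat) c x = #|C| + num_edges flat c.
Proof.
rewrite big_split /= sum1_card -size_edges; congr addn.
rewrite -(size_map (fun e : edgeT => edge_tgt e)).
rewrite (size_sum_count (enum_uniq C) (fun x _ => mem_enum C x)) big_enum /=.
apply: eq_bigr => x _; rewrite /edges_to filter_rev size_rev size_filter.
by rewrite count_map.
Qed.

Lemma partition_refinementP : exists P steps,
  [/\ partition_refinement M c P steps,
      forall x y, P x = P y <-> behaviourally_equivalent c x y &
      2 <= #|C| -> steps <= 300 * (T * ((num_edges flat c + #|C|) * tl #|C|))].
Proof.
have [[] [s [k1 [E1 [inv1 le1]]]]] := wpP (initializeP wF T_gt0 time_initP time_cmp3P).
have [s' [k2 [run inv2 wk0 le2]]] := loopP wF T_gt0 time_updateP time_cmp3P zipF inv1.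
exists (pblk s'), (k1 + k2); split.
- by exists s, s', k1, k2; split.
- exact: loop_inv_end inv2 wk0.
(* With at least two states the logarithm is at least 1 and absorbs the linear and constant
   terms. *)
move=> C2; have L_gt0 : 0 < tl #|C| by rewrite trunc_log_gt0.
have pQ := potential_le (degree (flat := flat) c) (qcls s).
have pP := potential_le (fun=> 1) (pblk s).
rewrite sum_degree in pQ; rewrite sum1_card in pP.
rewrite size_edges in le1.
apply: leq_trans (leq_add le1 le2) _; rewrite /measure.
move: (potential _ _) (potential _ _) pQ pP => b a.
move: (num_edges flat c) #|C| (tl #|C|) C2 L_gt0; clear -T_gt0 => m n L n2 L_gt0 pQ pP.
have mL : m <= m * L by rewrite leq_pmulr.
have nL : n <= n * L by rewrite leq_pmulr.
have : T * (9 * m + 40 * n + 21 + 20 * (n * L)) + (1 + T * (83 * a + 72 * b)) <=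
       T * (9 * m + 40 * n + 22 + 20 * (n * L) + 83 * a + 72 * b) by lia.
move=> /leq_trans; apply; rewrite [X in _ <= X]mulnCA leq_mul2l; apply/orP; right.
by lia.
Qed.

End TotalTime.

(** * From binary logarithms to real bounds *)

Import Order.TTheory GRing.Theory Num.Theory.

Lemma trunc_log_ln (R : realType) n : (0 < n)%N ->
  ((tl n)%:R * ln 2 <= ln n%:R :> R)%R.
Proof.
move=> n_gt0; rewrite mulrC mulr_natr -lnXn ?ltr0n // ler_ln ?posrE ?exprn_gt0 ?ltr0n //.
by rewrite -natrX ler_nat trunc_logP.
Qed.

Local Open Scope ring_scope.

Theorem theorem3p10 (R : realType) (F : set_functor) (A : Type)
    (flat : encoding F A) (I : refinement_interface flat)
    (M : implementation I) (p : forall X Y : Type, (X -> F Y) -> R) :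
  zippable F ->
  has_run_time_factor M p ->
  exists2 K : R, 0 < K &
  forall (C : finType) (c : C -> F C),
  exists (P : C -> nat) (steps : nat),
    [/\ partition_refinement M c P steps,
        forall x y : C, P x = P y <-> behaviourally_equivalent c x y &
        (2 <= #|C|)%N ->
        steps%:R <=
          K * ((num_edges flat c + #|C|)%:R * ln (#|C|%:R : R) * p C C c)].
Proof.
move=> zipF [K0 K0_gt0 timeP].
have [w wF] := weight_familyP I.
have ln2_gt0 : 0 < ln (2 : R) by rewrite ln_gt0 // ltr1n.
(* The 300 is that of [partition_refinementP], a factor 2 is lost by rounding [K0 * p] up to the
   natural number [T], and [ln 2] is the change of base. *)
exists (600 * K0 / ln 2); first by rewrite divr_gt0 ?mulr_gt0.
move=> C c; have [tI tU tC] := timeP C C c w wF.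
set q := K0 * p C C c.
(* The successor makes [T] positive and an upper bound of [q], whatever the sign of [q]. *)
pose T := (Num.truncn q).+1.
have qT : q <= T%:R by apply/ltW/truncnS_gt.
have bound t n : t%:R <= K0 * (n%:R * p C C c) -> (t <= T * n)%N.
  rewrite mulrCA -/q => tn; rewrite -(ler_nat R) natrM mulrC.
  by apply: le_trans tn _; rewrite ler_wpM2l.
have boundC u v : observations c u -> observations c v -> (time_cmp3 M u v <= T)%N.
  by move=> ou ov; rewrite -(ler_nat R); apply: le_trans (tC u v ou ov) qT.
have [P [steps [run beh le]]] := @partition_refinementP F A flat I M C c w wF T isT
  (fun x => bound _ _ (tI x)) (fun x S B SB => bound _ _ (tU x S B SB)) boundC zipF.
exists P, steps; split=> // C2.
have [x _] : exists x, x \in C by apply/card_gt0P/ltnW.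
(* Comparing the type of some state with itself takes at least one step, so [p] cannot be
   arbitrarily small and the rounding costs at most a factor 2. *)
have q_ge1 : 1 <= q.
  have o : observations c (type3 c x) := type3_obs c x.
  by apply: le_trans (tC _ _ o o); rewrite ler1n time_cmp3_gt0.
have T2 : T%:R <= 2 * q.
  rewrite /T -natr1; have := truncn_le q; rewrite (le_trans ler01 q_ge1).
  by move=> tq; rewrite mulr_natl mulr2n lerD.
have lnC := trunc_log_ln R (ltnW C2).
have {}le := le C2; rewrite -(ler_nat R) !natrM in le.
apply: le_trans le _.
set m := (num_edges _ _ + _)%:R.
have -> : 600 * K0 / ln 2 * (m * ln #|C|%:R * p C C c) =
    300 * ((2 * q) * (m * (ln #|C|%:R / ln 2))) by rewrite /q; field; rewrite gt_eqF.
rewrite ler_wpM2l // ler_pM ?mulr_ge0 ?ler0n // ler_wpM2l ?ler0n //.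
by rewrite ler_pdivlMr.
Qed.
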